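(* (a) Let $\alpha\in\mathbb{R}$. The function $x\mapsto \dfrac{[\Gamma(x+\alpha+1)]^{1/(x+\alpha)}}{[\Gamma(x+1)]^{1/x}}$ is logarithmically completely monotonic on $(-1,\infty)$ if and only if $\alpha>0$. (b) For real $\alpha\ge 1$ and $\beta>0$, the function $$x\mapsto \frac{[\Gamma(x+1)]^{1/x}}{[\Gamma(x+1+\beta)]^{1/(x+\beta)}}\left(1+\frac{\beta}{x+1}\right)^\alpha$$ is logarithmically completely monotonic on $(-1,\infty)$. For $\beta>0$ and any real number $\alpha$ satisfying $\alpha\le\frac{1}{1+\tau_0}<1$, the reciprocal of this function is logarithmically completely monotonic on $(-1,\infty)$. (c) For real $\alpha\ge 1$ and $\beta>0$, the function $$x\mapsto \frac{[\Gamma(x+1)]^{1/x}}{[\Gamma(x+1+\beta)]^{1/(x+\beta)}}\left(1+\frac{\beta}{x}\right)^\alpha$$ is logarithmically completely monotonic on $(0,\infty)$. For $\alpha\le 0$ and $\beta>0$, the reciprocal of this function is logarithmically completely monotonic on $(0,\infty)$.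
   Context: $\mathbb{N}=\{1,2,\dots\}$. A positive function $f$ on an interval $I$ is called logarithmically completely monotonic on $I$ if it has derivatives of all orders on $I$ and $(-1)^n[\ln f(x)]^{(n)}\ge 0$ for all $x\in I$ and all $n\in\mathbb{N}$. $\Gamma$ is the Euler gamma function. Convention: an expression $[\Gamma(y+1)]^{1/y}$ is assigned its limiting value $e^{-\gamma}$ at $y=0$, where $\gamma$ is the Euler–Mascheroni constant. The number $\tau_0=\tau(s_0,t_0)>0$ denotes the maximum on $\mathbb{N}\times(0,\infty)$ of the function $$\tau(s,t)=\frac1s\left[t-(t+s+1)\left(\frac{t}{t+1}\right)^{s+1}\right],\qquad (s,t)\in(0,\infty)\times(0,\infty).$$
   Formalization: In (a) the value α = 0 is excluded: there the function is the constant 1, which is logarithmically completely monotonic, so the equivalence fails. In (b) τ₀ is the supremum of τ on ℕ×(0,∞), which equals the maximum whenever one exists; numerically it is not attained. *)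

(* Defs.v *)
From Stdlib Require Export Reals.
From Coquelicot Require Export Coquelicot.
Open Scope R_scope.

(** [I] is meant to be an open interval: the derivatives are two-sided. *)
Definition log_completely_monotonic (I : R -> Prop) (f : R -> R) : Prop :=
  (forall x : R, I x -> 0 < f x) /\
  (forall (n : nat) (x : R), I x -> ex_derive_n f n x) /\
  (forall (n : nat) (x : R), (1 <= n)%nat -> I x ->
     0 <= (-1) ^ n * Derive_n (fun y => ln (f y)) n x).

(** Euler's integral, which converges exactly for [0 < x]; the value for
    [x <= 0] carries no meaning. *)
Definition Gamma (x : R) : R :=
  RInt_gen (fun t => Rpower t (x - 1) * exp (- t))
           (at_right 0) (Rbar_locally p_infty).

Definition Euler_Mascheroni : R :=
  real (Lim_seq (fun n => sum_n_m (fun k => / INR k) 1 n - ln (INR n))).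

(** [[Gamma (y + 1)]^(1/y)], with its limiting value at [y = 0]. *)
Definition Gamma_root (y : R) : R :=
  if Req_EM_T y 0 then exp (- Euler_Mascheroni)
  else Rpower (Gamma (y + 1)) (1 / y).

Definition tau (s t : R) : R :=
  1 / s * (t - (t + s + 1) * Rpower (t / (t + 1)) (s + 1)).

(** A supremum, not a maximum: numerically [tau0] is [0.2984...], approached as
    [s] tends to infinity and attained at no positive integer [s].  When a
    maximum exists the two coincide. *)
Definition tau0 : R :=
  real (Lub_Rbar (fun r => exists (s : nat) (t : R),
    (1 <= s)%nat /\ 0 < t /\ r = tau (INR s) t)).

(* Main.v *)
Require Import Defs.
From Stdlib Require Import Reals Lra Lia Factorial.
From Coquelicot Require Import Coquelicot.
Open Scope R_scope.

(** Weierstrass' product gives, for [phi x := ln (Gamma (x + 1)) / x] on [x > -1],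
    [phi x = - gamma + sum_(k >= 1) int_0^1 (1/k - 1/(k + u x)) du], whence
    [(-1)^(n-1) phi^(n) x = n! sum_k int_0^1 u^n / (k + u x)^(n+1) du].
    On the other hand, with [F y := (y + n) / y^(n+1)], one has
    [int_0^1 u^n F (1 + u x) du = 1 / (x + 1)^n], and telescoping
    [F (1 + u x) = sum_k (F (k + u x) - F (k + 1 + u x))], where
    [F y - F (y + 1) = (1 + tau n y) n / y^(n+1)].  Since [0 <= tau n y <= tau0],
    [(-1)^(n-1) phi^(n) x <= (n-1)! / (x + 1)^n <= (1 + tau0) (-1)^(n-1) phi^(n) x].
    These are sign conditions on the derivatives of [phi - alpha ln (x + c)];
    they make the differences of that function between [x] and [x + beta]
    completely monotonic. *)

(** * Derivative towers and logarithmic complete monotonicity *)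

(** The average over [u] is what removes the division by [x]. Multiplied by [x], each term
    integrates to [x/k - ln (1 + x/k)], so the series is [ln (Gamma (x + 1)) / x] away from 0; at 0
    its terms vanish and it takes the prescribed value [- gamma], so that smoothness across 0 needs
    no separate argument. The price is that each derivative is a series of integrals; a quadratic
    remainder estimate, summable in [k], differentiates under both signs at once. [Gamma],
    [Euler_Mascheroni] and [tau0] are given by total operators that return a value even without
    convergence or boundedness. Hence the convergence of Euler's integral, the existence of the
    limit defining gamma and the finiteness of the supremum are part of the proof. The converse in
    (a) is decided by a single first derivative: for negative [alpha] the function involves
    meaningless values of [Gamma_root] on part of the half-line, and the test point has to avoid
    them. *)

Lemma locally_gt (a x : R) : a < x -> locally x (fun y => a < y).
Proof. intros H; exact (open_gt a x H). Qed.

Lemma is_derive_continuity_pt (f : R -> R) (x l : R) :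
  is_derive f x l -> continuity_pt f x.
Proof.
  intros H; apply continuity_pt_filterlim.
  apply (ex_derive_continuous f x); exists l; exact H.
Qed.

(** The first derivative is peeled off and kept existential, so closure under products and [exp]
    follows by induction on the order, with no formula for the higher derivatives of a composite. *)
Fixpoint smooth (a : R) (n : nat) (f : R -> R) : Prop :=
  match n with
  | O => True
  | S m => exists f' : R -> R,
      (forall x, a < x -> is_derive f x (f' x)) /\ smooth a m f'
  end.

Lemma smooth_ex_derive_n (a : R) (n : nat) (f : R -> R) (x : R) :
  smooth a n f -> a < x -> ex_derive_n f n x.
Proof.
  revert f x; induction n as [|[|n] IH]; intros f x Hf Hx.
  - exact I.
  - destruct Hf as [f' [Hf _]]; exists (f' x); exact (Hf x Hx).
  - destruct Hf as [f' [Hf Hs]].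
    (* [ex_derive_n] adds a derivative on the outside, [smooth] on the inside; commuting the two
       reduces the goal to the induction hypothesis for [f']. *)
    apply ex_derive_ext_loc with (Derive_n f' n); [|exact (IH f' x Hs Hx)].
    apply filter_imp with (fun y => a < y); [|exact (locally_gt a x Hx)].
    intros y Hy.
    change (Derive_n f' n y = Derive_n f (S n) y).
    replace (S n) with (n + 1)%nat by lia.
    rewrite <- (Derive_n_comp f n 1).
    apply Derive_n_ext_loc.
    apply filter_imp with (fun y => a < y); [|exact (locally_gt a y Hy)].
    intros z Hz; symmetry; exact (is_derive_unique _ _ _ (Hf z Hz)).
Qed.

Lemma smooth_pred (a : R) (n : nat) (f : R -> R) :
  smooth a (S n) f -> smooth a n f.
Proof.
  revert f; induction n as [|n IH]; intros f [f' [H Hs]]; [exact I|].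
  exists f'; split; [exact H | exact (IH f' Hs)].
Qed.

Lemma smooth_plus (a : R) (n : nat) (f g : R -> R) :
  smooth a n f -> smooth a n g -> smooth a n (fun x => f x + g x).
Proof.
  revert f g; induction n as [|n IH]; [intros; exact I|].
  intros f g [f' [Hf Hf']] [g' [Hg Hg']].
  exists (fun x => f' x + g' x); split; [|exact (IH f' g' Hf' Hg')].
  intros x Hx; exact (is_derive_plus f g x _ _ (Hf x Hx) (Hg x Hx)).
Qed.

Lemma smooth_mult (a : R) (n : nat) (f g : R -> R) :
  smooth a n f -> smooth a n g -> smooth a n (fun x => f x * g x).
Proof.
  revert f g; induction n as [|n IH]; [intros; exact I|].
  intros f g Sf Sg; pose proof (smooth_pred _ _ _ Sf); pose proof (smooth_pred _ _ _ Sg).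
  destruct Sf as [f' [Hf Hf']], Sg as [g' [Hg Hg']].
  exists (fun x => f' x * g x + f x * g' x); split.
  - intros x Hx; exact (is_derive_mult f g x _ _ (Hf x Hx) (Hg x Hx) Rmult_comm).
  - apply smooth_plus; apply IH; assumption.
Qed.

Lemma smooth_exp (a : R) (n : nat) (f : R -> R) :
  smooth a n f -> smooth a n (fun x => exp (f x)).
Proof.
  revert f; induction n as [|n IH]; [intros; exact I|].
  intros f Sf; pose proof (smooth_pred _ _ _ Sf).
  destruct Sf as [f' [Hf Hf']].
  exists (fun x => f' x * exp (f x)); split.
  - intros x Hx; apply (is_derive_comp exp f x); [apply is_derive_exp | exact (Hf x Hx)].
  - apply smooth_mult; [assumption | apply IH; assumption].
Qed.

Definition tower (a : R) (G : nat -> R -> R) : Prop :=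
  forall n x, a < x -> is_derive (G n) x (G (S n) x).

Lemma tower_smooth (a : R) (G : nat -> R -> R) (n k : nat) :
  tower a G -> smooth a n (G k).
Proof.
  intros HG; revert k; induction n as [|n IH]; intros k; [exact I|].
  exists (G (S k)); split; [exact (HG k) | apply IH].
Qed.

Lemma tower_Derive_n (a : R) (G : nat -> R -> R) (f : R -> R) (n : nat) (x : R) :
  tower a G -> (forall y, a < y -> f y = G O y) -> a < x ->
  Derive_n f n x = G n x.
Proof.
  intros HG Hf; revert x; induction n as [|n IH]; intros x Hx; [exact (Hf x Hx)|].
  rewrite <- (is_derive_unique _ _ _ (HG n x Hx)).
  apply Derive_ext_loc.
  apply filter_imp with (fun y => a < y); [exact IH | exact (locally_gt a x Hx)].
Qed.

Lemma tower_lin (a u v : R) (G H : nat -> R -> R) :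
  tower a G -> tower a H -> tower a (fun n x => u * G n x + v * H n x).
Proof.
  intros HG HH n x Hx.
  apply (is_derive_plus (fun x => u * G n x) (fun x => v * H n x)).
  - exact (is_derive_scal (G n) x u _ (HG n x Hx)).
  - exact (is_derive_scal (H n) x v _ (HH n x Hx)).
Qed.

Lemma tower_shift (a b c : R) (G : nat -> R -> R) :
  a <= b + c -> tower a G -> tower b (fun n x => G n (x + c)).
Proof.
  intros Hc HG n x Hx.
  replace (G (S n) (x + c)) with (1 * G (S n) (x + c)) by ring.
  apply (is_derive_comp (G n) (fun x => x + c)).
  - apply HG; lra.
  - auto_derive; [exact I | ring].
Qed.

Lemma tower_weaken (a b : R) (G : nat -> R -> R) :
  a <= b -> tower a G -> tower b G.
Proof. intros Hab HG n x Hx; apply HG; lra. Qed.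

(** By the mean value theorem the difference is [- b] times [G (S n)] at an intermediate point, and
    this minus sign supplies the extra factor [-1]. *)
Lemma tower_diff_nonneg (a b x : R) (G : nat -> R -> R) (n : nat) :
  tower a G -> (forall y, a < y -> 0 <= (-1) ^ S n * G (S n) y) ->
  0 <= b -> a < x -> 0 <= (-1) ^ n * (G n x - G n (x + b)).
Proof.
  intros HG Hn Hb Hx.
  destruct (MVT_gen (G n) x (x + b) (G (S n))) as [c [Hc E]].
  - rewrite Rmin_left, Rmax_right by lra; intros y Hy; apply HG; lra.
  - rewrite Rmin_left, Rmax_right by lra; intros y Hy.
    apply (is_derive_continuity_pt _ _ (G (S n) y)), HG; lra.
  - rewrite Rmin_left, Rmax_right in Hc by lra.
    replace (G n x - G n (x + b)) with (- (G n (x + b) - G n x)) by ring.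
    rewrite E.
    replace ((-1) ^ n * - (G (S n) c * (x + b - x)))
      with ((-1) ^ S n * G (S n) c * b) by (simpl; ring).
    apply Rmult_le_pos; [apply Hn; lra | exact Hb].
Qed.

(** Differencing uses up one order of differentiation: the signs of [G] at orders from 2 on give
    those of [ln f] at orders from 1 on. *)
Lemma lcm_of_tower (a b : R) (G : nat -> R -> R) (f : R -> R) :
  tower a G -> 0 < b ->
  (forall n x, (2 <= n)%nat -> a < x -> 0 <= (-1) ^ n * G n x) ->
  (forall x, a < x -> f x = exp (G O x - G O (x + b))) ->
  log_completely_monotonic (fun x => a < x) f.
Proof.
  intros HG Hb Hpos Hf.
  set (T := fun n x => 1 * G n x + (-1) * G n (x + b)).
  assert (HT : tower a T).
  { apply (tower_lin a 1 (-1) G (fun n x => G n (x + b)) HG).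
    apply (tower_shift a); [lra | exact HG]. }
  assert (HfT : forall x, a < x -> f x = exp (T O x)).
  { intros x Hx; rewrite (Hf x Hx); unfold T; f_equal; ring. }
  split; [|split].
  - intros x Hx; rewrite (HfT x Hx); apply exp_pos.
  - intros n x Hx.
    apply ex_derive_n_ext_loc with (fun y => exp (T O y)).
    + apply filter_imp with (fun y => a < y); [|exact (locally_gt a x Hx)].
      intros y Hy; symmetry; exact (HfT y Hy).
    + apply (smooth_ex_derive_n a); [|exact Hx].
      apply smooth_exp, tower_smooth, HT.
  - intros n x Hn Hx.
    rewrite (tower_Derive_n a T); [|exact HT| |exact Hx].
    + unfold T; replace (1 * G n x + -1 * G n (x + b)) with (G n x - G n (x + b)) by ring.
      apply (tower_diff_nonneg a); [exact HG| |lra|exact Hx].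
      intros y Hy; apply Hpos; [lia | exact Hy].
    + intros y Hy; rewrite (HfT y Hy); apply ln_exp.
Qed.

(** * Bounds on tau *)

Lemma bernoulli (x : R) (n : nat) : -1 <= x -> 1 + INR n * x <= (1 + x) ^ n.
Proof.
  intros Hx; induction n as [|n IH]; [simpl; lra|].
  rewrite S_INR; simpl pow.
  assert (H := Rmult_le_compat_l (1 + x) _ _ ltac:(lra) IH).
  assert (0 <= INR n * (x * x)) by (apply Rmult_le_pos; [apply pos_INR | nra]).
  nra.
Qed.

Lemma tau_pow (n : nat) (t : R) : 0 < t ->
  tau (INR n) t = 1 / INR n * (t - (t + INR n + 1) * (t / (t + 1)) ^ S n).
Proof.
  intros Ht; unfold tau; rewrite <- S_INR, Rpower_pow; [reflexivity|].
  apply Rdiv_lt_0_compat; lra.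
Qed.

(** After division by [t * (t/(t+1))^(n+1)] this is Bernoulli's inequality at [1/t], namely
    [1 + (n+1)/t <= (1 + 1/t)^(n+1)]. *)
Lemma tau_nonneg (n : nat) (t : R) : (1 <= n)%nat -> 0 < t -> 0 <= tau (INR n) t.
Proof.
  intros Hn Ht; rewrite tau_pow by exact Ht.
  assert (Hn' : 0 < INR n) by (apply lt_0_INR; lia).
  apply Rmult_le_pos; [apply Rlt_le, Rdiv_lt_0_compat; lra|].
  assert (B := bernoulli (/ t) (S n)).
  assert (0 < / t) by (apply Rinv_0_lt_compat; lra).
  specialize (B ltac:(lra)); rewrite S_INR in B.
  assert (Hr : 0 < (t / (t + 1)) ^ S n) by (apply pow_lt, Rdiv_lt_0_compat; lra).
  assert (E : (1 + / t) ^ S n * (t / (t + 1)) ^ S n = 1).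
  { rewrite <- Rpow_mult_distr; replace ((1 + / t) * (t / (t + 1))) with 1 by (field; lra).
    apply pow1. }
  apply (Rmult_le_compat_r _ _ _ (Rlt_le _ _ Hr)) in B; rewrite E in B.
  apply (Rmult_le_compat_r t _ _ (Rlt_le _ _ Ht)) in B.
  replace ((1 + (INR n + 1) * / t) * (t / (t + 1)) ^ S n * t)
    with ((t + INR n + 1) * (t / (t + 1)) ^ S n) in B by (field; lra).
  lra.
Qed.

(** A crude bound, whose purpose is to make the supremum [tau0] finite. The claim is
    [t - n <= (t+n+1) * (t/(t+1))^(n+1)]: trivial for [t <= n], and otherwise Bernoulli at
    [-1/(t+1)], which bounds the right side below by [t - n (n+1)/(t+1)]. *)
Lemma tau_le_1 (n : nat) (t : R) : (1 <= n)%nat -> 0 < t -> tau (INR n) t <= 1.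
Proof.
  intros Hn Ht; rewrite tau_pow by exact Ht.
  assert (Hn' : 0 < INR n) by (apply lt_0_INR; lia).
  apply Rmult_le_reg_l with (INR n); [exact Hn'|].
  rewrite <- Rmult_assoc; replace (INR n * (1 / INR n)) with 1 by (field; lra).
  assert (Hr : 0 < (t / (t + 1)) ^ S n) by (apply pow_lt, Rdiv_lt_0_compat; lra).
  destruct (Rle_lt_dec t (INR n)) as [Htn|Htn].
  - assert (0 <= (t + INR n + 1) * (t / (t + 1)) ^ S n) by (apply Rmult_le_pos; lra).
    lra.
  - assert (H1 : 0 < / (t + 1) < 1).
    { split; [apply Rinv_0_lt_compat; lra|].
      rewrite <- Rinv_1; apply Rinv_lt_contravar; lra. }
    assert (B := bernoulli (- / (t + 1)) (S n) ltac:(lra)).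
    replace (1 + - / (t + 1)) with (t / (t + 1)) in B by (field; lra).
    rewrite S_INR in B.
    apply (Rmult_le_compat_l (t + INR n + 1)) in B; [|lra].
    replace ((t + INR n + 1) * (1 + (INR n + 1) * - / (t + 1)))
      with (t - INR n * ((INR n + 1) / (t + 1))) in B by (field; lra).
    assert ((INR n + 1) / (t + 1) <= 1).
    { apply Rmult_le_reg_r with (t + 1); [lra|].
      unfold Rdiv; rewrite Rmult_assoc, Rinv_l; lra. }
    nra.
Qed.

Lemma tau_le_tau0 (n : nat) (t : R) :
  (1 <= n)%nat -> 0 < t -> tau (INR n) t <= tau0.
Proof.
  intros Hn Ht; unfold tau0.
  match goal with |- _ <= real (Lub_Rbar ?E) =>
    destruct (Lub_Rbar_correct E) as [ub lub] end.
  assert (B : Rbar_le (tau (INR n) t) (Lub_Rbar (fun r => exists (s : nat) (t : R),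
    (1 <= s)%nat /\ 0 < t /\ r = tau (INR s) t))) by (apply ub; exists n, t; auto).
  specialize (lub (Finite 1)).
  (* [real] sends infinite values to 0, so both must be excluded: [tau_le_1] rules out [p_infty],
     and the membership of this value of [tau] rules out [m_infty]. *)
  destruct (Lub_Rbar _) as [l| |]; simpl in *; [exact B| |contradiction].
  destruct lub; intros r [m [u [Hm [Hu ->]]]]; exact (tau_le_1 m u Hm Hu).
Qed.

Lemma tau0_pos : 0 < tau0.
Proof.
  (* The value is [1 - 3/4 = 1/4]. *)
  apply Rlt_le_trans with (tau (INR 1) 1); [|apply tau_le_tau0; [lia|lra]].
  rewrite tau_pow by lra; simpl; lra.
Qed.

(* The function [F] of the header. *)
Definition tail_weight (n : nat) (y : R) : R := (y + INR n) / y ^ S n.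

Lemma tail_weight_diff (n : nat) (y : R) : (1 <= n)%nat -> 0 < y ->
  tail_weight n y - tail_weight n (y + 1) = (1 + tau (INR n) y) * (INR n / y ^ S n).
Proof.
  intros Hn Hy; rewrite tau_pow by exact Hy; unfold tail_weight.
  assert (0 < INR n) by (apply lt_0_INR; lia).
  assert (0 < y ^ S n) by (apply pow_lt; lra).
  assert (0 < (y + 1) ^ S n) by (apply pow_lt; lra).
  replace ((y / (y + 1)) ^ S n) with (y ^ S n / (y + 1) ^ S n)
    by (unfold Rdiv; rewrite Rpow_mult_distr, pow_inv; reflexivity).
  field; lra.
Qed.

Lemma tail_weight_diff_lower (n : nat) (y : R) : (1 <= n)%nat -> 0 < y ->
  INR n / y ^ S n <= tail_weight n y - tail_weight n (y + 1).
Proof.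
  intros Hn Hy; rewrite tail_weight_diff by assumption.
  assert (H := tau_nonneg n y Hn Hy).
  assert (0 <= INR n / y ^ S n)
    by (apply Rmult_le_pos; [apply pos_INR | apply Rlt_le, Rinv_0_lt_compat, pow_lt, Hy]).
  nra.
Qed.

Lemma tail_weight_diff_upper (n : nat) (y : R) : (1 <= n)%nat -> 0 < y ->
  tail_weight n y - tail_weight n (y + 1) <= (1 + tau0) * (INR n / y ^ S n).
Proof.
  intros Hn Hy; rewrite tail_weight_diff by assumption.
  apply Rmult_le_compat_r; [|generalize (tau_le_tau0 n y Hn Hy); lra].
  apply Rmult_le_pos; [apply pos_INR | apply Rlt_le, Rinv_0_lt_compat, pow_lt, Hy].
Qed.

(** * The kernel of the derivatives of phi *)

(** Adapted to termwise differentiation: remainder bounds add up over a series, so no theorem on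
    uniform convergence is involved. *)
Lemma is_derive_of_quadratic_remainder (F : R -> R) (x l e M : R) :
  0 < e ->
  (forall y, Rabs (y - x) < e -> Rabs (F y - F x - (y - x) * l) <= M * (y - x) ^ 2) ->
  is_derive F x l.
Proof.
  intros He H; apply is_derive_Reals; intros eps Heps.
  assert (Hd : 0 < Rmin e (eps / (Rabs M + 1))).
  { apply Rmin_pos; [exact He|]; apply Rdiv_lt_0_compat; [exact Heps|].
    generalize (Rabs_pos M); lra. }
  exists (mkposreal _ Hd); intros h Hh0 Hh; simpl in Hh.
  assert (H1 : Rabs (x + h - x) < e).
  { replace (x + h - x) with h by ring; apply Rlt_le_trans with (1 := Hh), Rmin_l. }
  specialize (H _ H1); replace (x + h - x) with h in H by ring.
  replace ((F (x + h) - F x) / h - l) with ((F (x + h) - F x - h * l) / h) by (field; auto).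
  assert (Ha : 0 < Rabs h) by (apply Rabs_pos_lt; auto).
  unfold Rdiv; rewrite Rabs_mult, Rabs_inv.
  apply Rle_lt_trans with ((Rabs M * Rabs h ^ 2) * / Rabs h).
  - apply Rmult_le_compat_r; [apply Rlt_le, Rinv_0_lt_compat, Ha|].
    apply Rle_trans with (1 := H); rewrite pow2_abs.
    apply Rmult_le_compat_r; [apply pow2_ge_0 | apply RRle_abs].
  - replace (Rabs M * Rabs h ^ 2 * / Rabs h) with (Rabs M * Rabs h) by (field; lra).
    assert (Hh2 : Rabs h < eps / (Rabs M + 1)) by (apply Rlt_le_trans with (1 := Hh), Rmin_r).
    assert (0 <= Rabs M) by apply Rabs_pos.
    apply Rle_lt_trans with ((Rabs M + 1) * Rabs h); [nra|].
    apply Rmult_lt_reg_r with (/ (Rabs M + 1)); [apply Rinv_0_lt_compat; lra|].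
    replace ((Rabs M + 1) * Rabs h * / (Rabs M + 1)) with (Rabs h) by (field; lra).
    exact Hh2.
Qed.

Lemma MVT_abs (f f' : R -> R) (x y e : R) :
  (forall z, Rabs (z - x) < e -> is_derive f z (f' z)) -> Rabs (y - x) < e ->
  exists c, Rabs (c - x) <= Rabs (y - x) /\ f y - f x = f' c * (y - x).
Proof.
  intros Hf Hy.
  assert (Hb : forall z, Rmin x y <= z <= Rmax x y -> Rabs (z - x) <= Rabs (y - x)).
  { intros z; unfold Rmin, Rmax; destruct (Rle_dec x y); intros Hz;
      unfold Rabs; destruct (Rcase_abs (z - x)), (Rcase_abs (y - x)); lra. }
  destruct (MVT_gen f x y f') as [c [Hc E]].
  - intros z Hz; apply Hf; apply Rle_lt_trans with (2 := Hy), Hb; lra.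
  - intros z Hz; apply (is_derive_continuity_pt _ _ (f' z)), Hf.
    apply Rle_lt_trans with (2 := Hy), Hb; lra.
  - exists c; split; [apply Hb; exact Hc | exact E].
Qed.

(** Two uses of the mean value theorem write the remainder as [f'' d * (c - x) * (y - x)] with [c]
    between [x] and [y]; this costs only the factor 1/2 of Taylor's formula. *)
Lemma quadratic_remainder (f f' f'' : R -> R) (x y e M : R) :
  (forall z, Rabs (z - x) < e -> is_derive f z (f' z)) ->
  (forall z, Rabs (z - x) < e -> is_derive f' z (f'' z)) ->
  (forall z, Rabs (z - x) < e -> Rabs (f'' z) <= M) ->
  Rabs (y - x) < e ->
  Rabs (f y - f x - (y - x) * f' x) <= M * (y - x) ^ 2.
Proof.
  intros Hf Hf' Hb Hy.
  destruct (MVT_abs f f' x y e Hf Hy) as [c [Hc E]].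
  destruct (MVT_abs f' f'' x c e Hf' ltac:(lra)) as [d [Hd E']].
  replace (f y - f x - (y - x) * f' x) with (f'' d * (c - x) * (y - x))
    by (rewrite E, <- E'; ring).
  rewrite !Rabs_mult, <- pow2_abs.
  specialize (Hb d ltac:(lra)).
  generalize (Rabs_pos (f'' d)) (Rabs_pos (c - x)) (Rabs_pos (y - x)); intros.
  simpl; rewrite Rmult_1_r, <- Rmult_assoc.
  apply Rmult_le_compat_r; [assumption|].
  apply Rmult_le_compat; assumption.
Qed.

Lemma is_series_telescope (a : nat -> R) (l : R) :
  is_lim_seq a l -> is_series (fun k => a k - a (S k)) (a O - l).
Proof.
  intros Ha; change (is_lim_seq (sum_n (fun k => a k - a (S k))) (a O - l)).
  apply (is_lim_seq_ext (fun n => a O - a (S n))).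
  - intros n; induction n as [|n IH]; [rewrite sum_O; reflexivity|].
    rewrite sum_Sn, <- IH; unfold plus; simpl; ring.
  - apply (is_lim_seq_minus' (fun _ => a O) (fun n => a (S n))); [apply is_lim_seq_const|].
    apply (is_lim_seq_incr_1 a); exact Ha.
Qed.

(** The majorant for all comparisons of series: summable because it telescopes, and at least half of
    [1/(k+1)^2]. *)
Definition gap (k : nat) : R := / INR (S k) - / INR (S (S k)).

Lemma is_lim_seq_inv_S : is_lim_seq (fun k => / INR (S k)) 0.
Proof.
  apply (is_lim_seq_incr_1 (fun k => / INR k)).
  apply (is_lim_seq_inv INR p_infty); [apply is_lim_seq_INR | discriminate].
Qed.

Lemma ex_series_gap : ex_series gap.
Proof. eexists; exact (is_series_telescope (fun k => / INR (S k)) 0 is_lim_seq_inv_S). Qed.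

Lemma inv_sqr_le_gap (k : nat) : / INR (S k) ^ 2 <= 2 * gap k.
Proof.
  unfold gap; rewrite !S_INR; assert (H := pos_INR k).
  replace (2 * (/ (INR k + 1) - / (INR k + 1 + 1)))
    with (/ ((INR k + 1) * (INR k + 2) / 2)) by (field; lra).
  apply Rinv_le_contravar; nra.
Qed.

(* The [n]-th derivative in [x] of [1/(k+1) - 1/(k+1 + u x)], with [k] counted
   from [0]. *)
Definition kern (n k : nat) (u x : R) : R :=
  (match n with O => / INR (S k) | S _ => 0 end)
  - (-1) ^ n * INR (fact n) * u ^ n / (INR (S k) + u * x) ^ S n.

(** The right side is at least [k + d]. Keeping [x] at distance [d] from the singularity at -1 makes
    the bound uniform in [x] and [u]. *)
Lemma base_lower (d x u : R) (k : nat) :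
  0 < d <= 1 -> -1 + d <= x -> 0 <= u <= 1 -> d * INR (S k) <= INR (S k) + u * x.
Proof.
  intros Hd Hx Hu; rewrite S_INR; assert (H := pos_INR k).
  assert (u * (-1 + d) <= u * x) by (apply Rmult_le_compat_l; lra).
  nra.
Qed.

Lemma base_pos (x u : R) (k : nat) :
  -1 < x -> 0 <= u <= 1 -> 0 < INR (S k) + u * x.
Proof.
  intros Hx Hu; rewrite S_INR; assert (H := pos_INR k).
  destruct (Rle_lt_dec 0 x); nra.
Qed.

Lemma is_derive_kern (n k : nat) (u x : R) :
  -1 < x -> 0 <= u <= 1 -> is_derive (kern n k u) x (kern (S n) k u x).
Proof.
  intros Hx Hu; assert (Hb := base_pos x u k Hx Hu).
  unfold kern; revert Hb; generalize (INR (S k)); intros K Hb.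
  assert (0 < (K + u * x) ^ n) by (apply pow_lt, Hb).
  auto_derive.
  - apply Rgt_not_eq, Rmult_lt_0_compat; assumption.
  - change (fact (S n)) with (S n * fact n)%nat; rewrite mult_INR, S_INR.
    simpl pow.
    change (match n with O => 1 | S _ => INR n + 1 end) with (INR (S n)).
    rewrite S_INR; field; lra.
Qed.

(** From order 1 on, each term is already of size [k^(-2)] or smaller. The constant depends on [d]
    but not on [x], as required for a remainder estimate on a neighbourhood. *)
Lemma kern_bound_S (d : R) (n : nat) : 0 < d <= 1 ->
  exists C, forall k u x, -1 + d <= x -> 0 <= u <= 1 ->
    Rabs (kern (S n) k u x) <= C * gap k.
Proof.
  intros Hd; exists (INR (fact (S n)) * / d ^ S (S n) * 2); intros k u x Hx Hu.
  assert (Hb := base_lower d x u k Hd Hx Hu).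
  assert (Hb' := base_pos x u k ltac:(lra) Hu).
  assert (HS : 1 <= INR (S k)) by (rewrite S_INR; generalize (pos_INR k); lra).
  unfold kern.
  replace (0 - (-1) ^ S n * INR (fact (S n)) * u ^ S n / (INR (S k) + u * x) ^ S (S n))
    with (- (((-1) ^ S n) * (INR (fact (S n)) * (u ^ S n * / (INR (S k) + u * x) ^ S (S n)))))
    by (unfold Rdiv; ring).
  rewrite Rabs_Ropp, Rabs_mult, pow_1_abs, Rmult_1_l.
  assert (0 <= u ^ S n <= 1).
  { split; [apply pow_le; lra|]. rewrite <- (pow1 (S n)); apply pow_incr; lra. }
  assert (0 < / (INR (S k) + u * x) ^ S (S n)) by (apply Rinv_0_lt_compat, pow_lt, Hb').
  assert (0 <= INR (fact (S n))) by apply pos_INR.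
  rewrite Rabs_right by (apply Rle_ge, Rmult_le_pos; [lra | apply Rmult_le_pos; lra]).
  rewrite !Rmult_assoc; apply Rmult_le_compat_l; [assumption|].
  apply Rle_trans with (1 * / (INR (S k) + u * x) ^ S (S n)).
  { apply Rmult_le_compat_r; lra. }
  rewrite Rmult_1_l.
  apply Rle_trans with (/ (d * INR (S k)) ^ S (S n)).
  { assert (0 < d * INR (S k)) by (apply Rmult_lt_0_compat; lra).
    apply Rinv_le_contravar; [apply pow_lt; assumption | apply pow_incr; lra]. }
  rewrite Rpow_mult_distr, Rinv_mult.
  apply Rmult_le_compat_l; [apply Rlt_le, Rinv_0_lt_compat, pow_lt; lra|].
  apply Rle_trans with (2 := inv_sqr_le_gap k).
  apply Rinv_le_contravar; [nra|].
  apply Rle_pow; [exact HS | lia].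
Qed.

Lemma kern_bound (n : nat) (x : R) : -1 < x ->
  exists C, forall k u, 0 <= u <= 1 -> Rabs (kern n k u x) <= C * gap k.
Proof.
  intros Hx.
  set (d := Rmin 1 (x + 1)).
  assert (Hd : 0 < d <= 1) by (split; [apply Rmin_pos; lra | apply Rmin_l]).
  assert (Hdx : -1 + d <= x) by (generalize (Rmin_r 1 (x + 1)); fold d; lra).
  destruct n as [|n].
  (* At order 0 each of the two fractions is only of size [1/k]; their difference is [u x] over the
     product of the denominators, which is summable. *)
  - exists (Rabs x * / d * 2); intros k u Hu.
    assert (Hb := base_lower d x u k Hd Hdx Hu).
    assert (Hb' := base_pos x u k ltac:(lra) Hu).
    assert (HS : 1 <= INR (S k)) by (rewrite S_INR; generalize (pos_INR k); lra).
    unfold kern.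
    replace (/ INR (S k) - (-1) ^ 0 * INR (fact 0) * u ^ 0 / (INR (S k) + u * x) ^ 1)
      with (u * x * (/ INR (S k) * / (INR (S k) + u * x))) by (cbv [pow fact]; simpl INR at 4; field; lra).
    rewrite !Rabs_mult, (Rabs_right u), (Rabs_inv (INR (S k))), Rabs_inv by lra.
    rewrite (Rabs_right (INR (S k))), (Rabs_right (INR (S k) + u * x)) by lra.
    assert (Hi : / (INR (S k) + u * x) <= / d * / INR (S k)).
    { rewrite <- Rinv_mult; apply Rinv_le_contravar; nra. }
    assert (0 < / INR (S k)) by (apply Rinv_0_lt_compat; lra).
    assert (0 < / (INR (S k) + u * x)) by (apply Rinv_0_lt_compat; lra).
    assert (0 < / d) by (apply Rinv_0_lt_compat; lra).
    assert (Hg := inv_sqr_le_gap k).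
    replace (/ INR (S k) ^ 2) with (/ INR (S k) * / INR (S k)) in Hg by (field; lra).
    assert (Hax := Rabs_pos x).
    apply Rle_trans with (1 * Rabs x * (/ INR (S k) * (/ d * / INR (S k)))).
    + apply Rmult_le_compat; [nra|nra|nra|]. apply Rmult_le_compat_l; lra.
    + replace (1 * Rabs x * (/ INR (S k) * (/ d * / INR (S k))))
        with ((Rabs x * / d) * (/ INR (S k) * / INR (S k))) by ring.
      rewrite (Rmult_assoc (Rabs x * / d)); apply Rmult_le_compat_l; [nra | exact Hg].
  - destruct (kern_bound_S d n Hd) as [C HC]; exists C; intros k u Hu; apply HC; assumption.
Qed.

(** * Integration over u, summation over k, and termwise differentiation *)

Lemma ex_RInt_01 (f : R -> R) :
  (forall u, 0 <= u <= 1 -> ex_derive f u) -> ex_RInt f 0 1.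
Proof.
  intros H; apply (ex_RInt_continuous f); intros u Hu.
  rewrite Rmin_left, Rmax_right in Hu by lra.
  apply (ex_derive_continuous f u), H, Hu.
Qed.

Lemma ex_RInt_kern (n k : nat) (x : R) :
  -1 < x -> ex_RInt (fun u => kern n k u x) 0 1.
Proof.
  intros Hx; apply ex_RInt_01; intros u Hu.
  assert (Hb := base_pos x u k Hx Hu).
  unfold kern; revert Hb; generalize (INR (S k)); intros K Hb.
  assert (0 < (K + u * x) ^ n) by (apply pow_lt, Hb).
  auto_derive; apply Rgt_not_eq, Rmult_lt_0_compat; assumption.
Qed.

Definition ikern (n k : nat) (x : R) : R := RInt (fun u => kern n k u x) 0 1.

Lemma is_RInt_ikern (n k : nat) (x : R) :
  -1 < x -> is_RInt (fun u => kern n k u x) 0 1 (ikern n k x).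
Proof. intros Hx; apply (RInt_correct (fun u => kern n k u x)), ex_RInt_kern, Hx. Qed.

Lemma Rabs_RInt_01_le (f : R -> R) (l M : R) :
  is_RInt f 0 1 l -> (forall u, 0 <= u <= 1 -> Rabs (f u) <= M) -> Rabs l <= M.
Proof.
  intros Hf HM.
  replace M with ((1 - 0) * M) by ring.
  apply (norm_RInt_le_const f 0 1 l M); [lra | exact HM | exact Hf].
Qed.

Lemma ex_series_ikern (n : nat) (x : R) : -1 < x -> ex_series (fun k => ikern n k x).
Proof.
  intros Hx; destruct (kern_bound n x Hx) as [C HC].
  apply (ex_series_le (fun k => ikern n k x) (fun k => C * gap k)).
  - intros k; apply (Rabs_RInt_01_le _ _ _ (is_RInt_ikern n k x Hx)).
    intros u Hu; exact (HC k u Hu).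
  - apply (ex_series_scal_l C gap), ex_series_gap.
Qed.

(** The series is taken as the definition, regular at [x = 0]; it is connected to [Gamma] only in
    [ln_Gamma_eq]. *)
Definition phi (n : nat) (x : R) : R :=
  (match n with O => - Euler_Mascheroni | S _ => 0 end)
  + Series (fun k => ikern n k x).

Lemma phi_tower : tower (-1) phi.
Proof.
  intros n x Hx.
  set (d := Rmin 1 ((x + 1) / 2)).
  assert (Hd : 0 < d <= 1) by (split; [apply Rmin_pos; lra | apply Rmin_l]).
  assert (Hdx : -1 + d <= x - (x + 1) / 2)
    by (generalize (Rmin_r 1 ((x + 1) / 2)); fold d; lra).
  (* The remainder of [kern n] is governed by its second derivative, of order [S (S n)]; the choice
     of [d] makes the bound hold on the whole ball of radius [(x + 1) / 2]. *)
  destruct (kern_bound_S d (S n) Hd) as [C HC].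
  assert (Hnear : forall z, Rabs (z - x) < (x + 1) / 2 -> -1 < z /\ -1 + d <= z).
  { intros z Hz; apply Rabs_def2 in Hz; lra. }
  apply (is_derive_of_quadratic_remainder _ x _ ((x + 1) / 2) (C * Series gap)); [lra|].
  intros y Hy; destruct (Hnear y Hy) as [Hy1 Hyd].
  set (r := fun k => ikern n k y - ikern n k x - (y - x) * ikern (S n) k x).
  assert (Hr : forall k, Rabs (r k) <= C * (y - x) ^ 2 * gap k).
  { intros k.
    apply (Rabs_RInt_01_le
      (fun u => kern n k u y - kern n k u x - (y - x) * kern (S n) k u x)).
    - unfold r.
      apply (is_RInt_minus (fun u => kern n k u y - kern n k u x)
               (fun u => (y - x) * kern (S n) k u x)).
      + apply (is_RInt_minus (fun u => kern n k u y) (fun u => kern n k u x));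
          apply is_RInt_ikern; assumption.
      + apply (is_RInt_scal (fun u => kern (S n) k u x)), is_RInt_ikern, Hx.
    - intros u Hu.
      replace (C * (y - x) ^ 2 * gap k) with (C * gap k * (y - x) ^ 2) by ring.
      apply (quadratic_remainder (kern n k u) (kern (S n) k u) (kern (S (S n)) k u)
               x y ((x + 1) / 2)); [| | |exact Hy];
        intros z Hz; destruct (Hnear z Hz) as [Hz1 Hz2].
      + apply is_derive_kern; assumption.
      + apply is_derive_kern; assumption.
      + apply HC; assumption. }
  assert (Er : is_series r (phi n y - phi n x - (y - x) * phi (S n) x)).
  { unfold phi.
    replace (match n with O => - Euler_Mascheroni | S _ => 0 end
        + Series (fun k => ikern n k y)
        - (match n with O => - Euler_Mascheroni | S _ => 0 end
           + Series (fun k => ikern n k x))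
        - (y - x) * (0 + Series (fun k => ikern (S n) k x)))
      with (Series (fun k => ikern n k y) - Series (fun k => ikern n k x)
        - (y - x) * Series (fun k => ikern (S n) k x)) by ring.
    apply (is_series_minus (fun k => ikern n k y - ikern n k x)
             (fun k => (y - x) * ikern (S n) k x)).
    - apply (is_series_minus (fun k => ikern n k y) (fun k => ikern n k x));
        apply Series_correct, ex_series_ikern; assumption.
    - apply (is_series_scal_l (y - x) (fun k => ikern (S n) k x)).
      apply Series_correct, ex_series_ikern, Hx. }
  assert (Hg : ex_series (fun k => C * (y - x) ^ 2 * gap k))
    by (apply (ex_series_scal_l (C * (y - x) ^ 2) gap), ex_series_gap).
  rewrite <- (is_series_unique _ _ Er).
  apply Rle_trans with (Series (fun k => Rabs (r k))).
  - apply Series_Rabs.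
    apply (ex_series_le (fun k => Rabs (r k)) (fun k => C * (y - x) ^ 2 * gap k));
      [|exact Hg].
    intros k; change (Rabs (Rabs (r k)) <= C * (y - x) ^ 2 * gap k).
    rewrite Rabs_Rabsolu; apply Hr.
  - replace (C * Series gap * (y - x) ^ 2) with (Series (fun k => C * (y - x) ^ 2 * gap k))
      by (rewrite Series_scal_l; ring).
    apply Series_le; [|exact Hg].
    intros k; split; [apply Rabs_pos | apply Hr].
Qed.

(** * Telescoping tails and the two-sided bounds on the derivatives of phi *)

Definition weighted_tail (n m : nat) (x : R) : R :=
  RInt (fun u => u ^ n * tail_weight n (INR (S m) + u * x)) 0 1.

Lemma is_RInt_weighted_tail (n m : nat) (x : R) : -1 < x ->
  is_RInt (fun u => u ^ n * tail_weight n (INR (S m) + u * x)) 0 1 (weighted_tail n m x).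
Proof.
  intros Hx; apply (RInt_correct (fun u => u ^ n * tail_weight n (INR (S m) + u * x))).
  apply ex_RInt_01; intros u Hu.
  assert (Hb := base_pos x u m Hx Hu).
  unfold tail_weight; revert Hb; generalize (INR (S m)); intros K Hb.
  assert (0 < (K + u * x) ^ n) by (apply pow_lt, Hb).
  auto_derive; apply Rgt_not_eq, Rmult_lt_0_compat; assumption.
Qed.

(** Here lies the origin of [tail_weight]: [u^n * tail_weight n (1 + u x)] is the derivative in [u]
    of [u^(n+1) / (1 + u x)^n]. *)
Lemma weighted_tail_0 (n : nat) (x : R) :
  -1 < x -> weighted_tail n O x = / (x + 1) ^ n.
Proof.
  intros Hx; apply is_RInt_unique.
  replace (/ (x + 1) ^ n)
    with (minus (1 ^ S n / (INR 1 + 1 * x) ^ n) (0 ^ S n / (INR 1 + 0 * x) ^ n)).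
  - apply (is_RInt_derive (fun u => u ^ S n / (INR 1 + u * x) ^ n));
      rewrite Rmin_left, Rmax_right by lra; intros u Hu;
      assert (Hb := base_pos x u O Hx Hu).
    + unfold tail_weight; change (INR 1) with 1 in *.
      destruct n as [|n].
      * auto_derive; [lra | simpl; field; lra].
      * assert (0 < (1 + u * x) ^ n) by (apply pow_lt, Hb).
        auto_derive; [apply Rgt_not_eq, Rmult_lt_0_compat; assumption|].
        simpl pow; change (match n with O => 1 | S _ => INR n + 1 end) with (INR (S n)).
        rewrite S_INR; field; lra.
    + apply (ex_derive_continuous (fun u => u ^ n * tail_weight n (INR 1 + u * x))).
      unfold tail_weight; revert Hb; generalize (INR 1); intros K Hb.
      assert (0 < (K + u * x) ^ n) by (apply pow_lt, Hb).
      auto_derive; apply Rgt_not_eq, Rmult_lt_0_compat; assumption.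
  - rewrite pow1; replace (INR 1 + 1 * x) with (x + 1) by (simpl; ring).
    unfold minus, plus, opp; simpl; assert (0 < (x + 1) ^ n) by (apply pow_lt; lra).
    unfold Rdiv; rewrite Rmult_0_l, Rmult_0_l; ring.
Qed.

Lemma weighted_tail_lim (n : nat) (x : R) : (1 <= n)%nat -> -1 < x ->
  is_lim_seq (fun m => weighted_tail n m x) 0.
Proof.
  (* Dropping the first term absorbs [u x >= -1]: the base [b] is then at least [INR (S m) >= 1],
     and [(b + n) / b^(n+1) <= (n + 1) / b]. *)
  intros Hn Hx; apply is_lim_seq_incr_1.
  apply (is_lim_seq_le_le (fun m => - ((INR n + 1) * / INR (S m))) _
           (fun m => (INR n + 1) * / INR (S m))).
  - intros m; apply Rabs_le_between.
    apply (Rabs_RInt_01_le _ _ _ (is_RInt_weighted_tail n (S m) x Hx)); intros u Hu.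
    assert (Hm : 1 <= INR (S m)) by (rewrite S_INR; generalize (pos_INR m); lra).
    assert (Hb : INR (S m) <= INR (S (S m)) + u * x) by (rewrite (S_INR (S m)); nra).
    revert Hb; generalize (INR (S (S m)) + u * x); intros b Hb.
    assert (Hn0 := pos_INR n).
    unfold tail_weight.
    assert (Hu1 : 0 <= u ^ n <= 1).
    { split; [apply pow_le; lra|]. rewrite <- (pow1 n); apply pow_incr; lra. }
    assert (Hbn : b ^ 2 <= b ^ S n) by (apply Rle_pow; [lra | lia]).
    assert (Hb2 : 0 < b ^ 2) by (apply pow_lt; lra).
    assert (Hi : 0 < / b ^ S n) by (apply Rinv_0_lt_compat; lra).
    assert (Hq : 0 <= (b + INR n) / b ^ S n)
      by (apply Rmult_le_pos; lra).
    rewrite Rabs_right by (apply Rle_ge, Rmult_le_pos; lra).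
    apply Rle_trans with (1 * ((b + INR n) / b ^ S n)); [apply Rmult_le_compat_r; lra|].
    rewrite Rmult_1_l; apply Rle_trans with ((INR n + 1) * b * / b ^ 2).
    + apply Rmult_le_compat; [lra|lra|nra|apply Rinv_le_contravar; assumption].
    + replace ((INR n + 1) * b * / b ^ 2) with ((INR n + 1) * / b) by (field; lra).
      apply Rmult_le_compat_l; [lra | apply Rinv_le_contravar; lra].
  - replace (Finite 0) with (Rbar_opp (Rbar_mult (INR n + 1) 0)) by (simpl; f_equal; ring).
    apply -> is_lim_seq_opp; apply is_lim_seq_scal_l, is_lim_seq_inv_S.
  - replace (Finite 0) with (Rbar_mult (INR n + 1) 0) by (simpl; f_equal; ring).
    apply is_lim_seq_scal_l, is_lim_seq_inv_S.
Qed.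

Lemma kern_S_sign (p k : nat) (u x : R) :
  (-1) ^ p * kern (S p) k u x
  = INR (fact p) * (u ^ S p * (INR (S p) / (INR (S k) + u * x) ^ S (S p))).
Proof.
  unfold kern; change (fact (S p)) with (S p * fact p)%nat; rewrite mult_INR.
  change ((-1) ^ S p) with (-1 * (-1) ^ p).
  assert (E : (-1) ^ p * (-1) ^ p = 1).
  { rewrite <- Rpow_mult_distr; replace (-1 * -1) with 1 by ring; apply pow1. }
  unfold Rdiv.
  replace ((-1) ^ p * (0 - -1 * (-1) ^ p * (INR (S p) * INR (fact p)) * u ^ S p
      * / (INR (S k) + u * x) ^ S (S p)))
    with ((-1) ^ p * (-1) ^ p * (INR (fact p) * (u ^ S p * (INR (S p)
      * / (INR (S k) + u * x) ^ S (S p))))) by ring.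
  rewrite E; ring.
Qed.

Lemma ikern_bounds (p k : nat) (x : R) : -1 < x ->
  0 <= (-1) ^ p * ikern (S p) k x
    <= INR (fact p) * (weighted_tail (S p) k x - weighted_tail (S p) (S k) x) /\
  INR (fact p) * (weighted_tail (S p) k x - weighted_tail (S p) (S k) x)
    <= (1 + tau0) * ((-1) ^ p * ikern (S p) k x).
Proof.
  intros Hx.
  assert (HI : is_RInt (fun u => (-1) ^ p * kern (S p) k u x) 0 1 ((-1) ^ p * ikern (S p) k x)).
  { apply (is_RInt_scal (fun u => kern (S p) k u x)), is_RInt_ikern, Hx. }
  assert (HJ := is_RInt_scal _ _ _ (INR (fact p)) _ (is_RInt_minus _ _ _ _ _ _
    (is_RInt_weighted_tail (S p) k x Hx) (is_RInt_weighted_tail (S p) (S k) x Hx))).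
  assert (H0 : is_RInt (fun _ : R => 0) 0 1 0).
  { assert (H : is_RInt (fun _ : R => 0) 0 1 ((1 - 0) * 0)) by exact (is_RInt_const 0 1 0).
    rewrite Rmult_0_r in H; exact H. }
  assert (HT := is_RInt_scal _ _ _ (1 + tau0) _ HI).
  assert (Hf : 0 < INR (fact p)) by apply INR_fact_lt_0.
  assert (Hpt : forall u, 0 < u < 1 -> exists b, 0 < b /\ INR (S k) + u * x = b /\
     INR (S (S k)) + u * x = b + 1 /\ 0 <= u ^ S p).
  { intros u Hu; exists (INR (S k) + u * x); repeat split.
    - apply base_pos; lra.
    - rewrite (S_INR (S k)); ring.
    - apply pow_le; lra. }
  repeat split.
  - apply (is_RInt_le _ _ 0 1 _ _ ltac:(lra) H0 HI); intros u Hu.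
    destruct (Hpt u Hu) as [b [Hb [E1 [E2 Hup]]]].
    rewrite kern_S_sign, E1.
    apply Rmult_le_pos; [lra|]; apply Rmult_le_pos; [exact Hup|].
    apply Rmult_le_pos; [apply pos_INR | apply Rlt_le, Rinv_0_lt_compat, pow_lt, Hb].
  - apply (is_RInt_le _ _ 0 1 _ _ ltac:(lra) HI HJ); intros u Hu.
    destruct (Hpt u Hu) as [b [Hb [E1 [E2 Hup]]]].
    rewrite kern_S_sign, E1, E2.
    apply Rmult_le_compat_l; [lra|]; unfold minus, plus, opp; simpl plus.
    assert (H := tail_weight_diff_lower (S p) b ltac:(lia) Hb).
    apply (Rmult_le_compat_l _ _ _ Hup) in H.
    change (u ^ S p * (INR (S p) / b ^ S (S p)) <= u ^ S p * tail_weight (S p) b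
      + - (u ^ S p * tail_weight (S p) (b + 1))).
    lra.
  - apply (is_RInt_le _ _ 0 1 _ _ ltac:(lra) HJ HT); intros u Hu.
    destruct (Hpt u Hu) as [b [Hb [E1 [E2 Hup]]]].
    rewrite kern_S_sign, E1, E2.
    assert (H := tail_weight_diff_upper (S p) b ltac:(lia) Hb).
    apply (Rmult_le_compat_l _ _ _ Hup) in H.
    apply (Rmult_le_compat_l _ _ _ (Rlt_le _ _ Hf)) in H.
    change (INR (fact p) * (u ^ S p * tail_weight (S p) b
      + - (u ^ S p * tail_weight (S p) (b + 1)))
      <= (1 + tau0) * (INR (fact p) * (u ^ S p * (INR (S p) / b ^ S (S p))))).
    lra.
Qed.

Lemma phi_S_bounds (p : nat) (x : R) : -1 < x ->
  (-1) ^ p * phi (S p) x <= INR (fact p) / (x + 1) ^ S p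
    <= (1 + tau0) * ((-1) ^ p * phi (S p) x).
Proof.
  intros Hx.
  set (w := fun k => INR (fact p) * (weighted_tail (S p) k x - weighted_tail (S p) (S k) x)).
  assert (Hw : is_series w (INR (fact p) / (x + 1) ^ S p)).
  { replace (INR (fact p) / (x + 1) ^ S p)
      with (INR (fact p) * (weighted_tail (S p) O x - 0))
      by (rewrite weighted_tail_0 by exact Hx; unfold Rdiv; ring).
    apply (is_series_scal_l (INR (fact p))
      (fun k => weighted_tail (S p) k x - weighted_tail (S p) (S k) x)).
    apply (is_series_telescope (fun k => weighted_tail (S p) k x)).
    apply weighted_tail_lim; [lia | exact Hx]. }
  replace ((-1) ^ p * phi (S p) x) with (Series (fun k => (-1) ^ p * ikern (S p) k x))
    by (unfold phi; rewrite Series_scal_l; ring).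
  assert (Hi : ex_series (fun k => (-1) ^ p * ikern (S p) k x))
    by (apply (ex_series_scal_l ((-1) ^ p) (fun k => ikern (S p) k x)), ex_series_ikern, Hx).
  rewrite <- (is_series_unique _ _ Hw), <- Series_scal_l.
  split; apply Series_le.
  - intros k; apply ikern_bounds, Hx.
  - eexists; exact Hw.
  - intros k; destruct (ikern_bounds p k x Hx) as [[H1 H2] H3].
    split; [apply Rle_trans with (1 := H1) (2 := H2) | exact H3].
  - apply (ex_series_scal_l (1 + tau0) (fun k => (-1) ^ p * ikern (S p) k x)), Hi.
Qed.

(** * The Gamma function *)

Lemma filter_prod_0_infty (P : R * R -> Prop) (a b : R) : 0 < a ->
  (forall u v, 0 < u < a -> b < v -> P (u, v)) ->
  filter_prod (at_right 0) (Rbar_locally p_infty) P.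
Proof.
  intros Ha HP.
  apply (Filter_prod _ _ _ (fun u => 0 < u < a) (fun v => b < v)).
  - exists (mkposreal a Ha); intros y Hy Hy0; split; [exact Hy0|].
    change (Rabs (y - 0) < a) in Hy; apply Rabs_def2 in Hy; lra.
  - exists b; intros v Hv; exact Hv.
  - exact HP.
Qed.

(** The limit is the supremum of the proper integrals. Since [f] is nonnegative, enlarging an
    interval that comes within [eps] of the supremum stays within [eps]. The second conclusion later
    yields the positivity of [Gamma]. *)
Lemma RInt_gen_of_bounded (f : R -> R) (M : R) :
  (forall t, 0 < t -> continuous f t) -> (forall t, 0 < t -> 0 <= f t) ->
  (forall a b, 0 < a <= b -> RInt f a b <= M) ->
  exists L, is_RInt_gen f (at_right 0) (Rbar_locally p_infty) L /\
    forall a b, 0 < a <= b -> RInt f a b <= L.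
Proof.
  intros Hc Hf HM.
  assert (Hex : forall a b, 0 < a -> 0 < b -> ex_RInt f a b).
  { intros a b Ha Hb; apply (ex_RInt_continuous f); intros z Hz; apply Hc.
    apply Rlt_le_trans with (2 := proj1 Hz), Rmin_pos; assumption. }
  destruct (completeness (fun r => exists a b, 0 < a <= b /\ r = RInt f a b))
    as [L [Hub Hlub]].
  - exists M; intros r [a [b [Hab ->]]]; exact (HM a b Hab).
  - exists (RInt f 1 1), 1, 1; split; [lra | reflexivity].
  - assert (HL : forall a b, 0 < a <= b -> RInt f a b <= L)
      by (intros a b Hab; apply Hub; exists a, b; split; [exact Hab | reflexivity]).
    exists L; split; [|exact HL].
    intros P [eps HP].
    assert (Hab0 : exists a0 b0, 0 < a0 <= b0 /\ L - eps < RInt f a0 b0).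
    { apply Classical_Prop.NNPP; intros Hno.
      assert (L <= L - eps); [|generalize (cond_pos eps); lra].
      apply Hlub; intros r [a [b [Hab ->]]]; apply Rnot_lt_le; intros Hlt.
      apply Hno; exists a, b; split; assumption. }
    destruct Hab0 as [a0 [b0 [[Ha0 Hab0] Hlt]]].
    apply (filter_prod_0_infty _ a0 b0 Ha0); intros u v Hu Hv; simpl.
    exists (RInt f u v); split; [apply (RInt_correct f), Hex; lra|].
    apply HP; change (Rabs (RInt f u v - L) < eps).
    assert (H1 := HL u v ltac:(lra)).
    assert (E : RInt f u v = RInt f u a0 + RInt f a0 b0 + RInt f b0 v).
    { rewrite <- (RInt_Chasles f u b0 v), <- (RInt_Chasles f u a0 b0);
        try (apply Hex; lra); reflexivity. }
    assert (P1 : 0 <= RInt f u a0)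
      by (apply RInt_ge_0; [lra | apply Hex; lra | intros; apply Hf; lra]).
    assert (P2 : 0 <= RInt f b0 v)
      by (apply RInt_ge_0; [lra | apply Hex; lra | intros; apply Hf; lra]).
    apply Rabs_def1; generalize (cond_pos eps); lra.
Qed.

Lemma RInt_gen_0_infty_le (f g : R -> R) (lf lg : R) :
  is_RInt_gen f (at_right 0) (Rbar_locally p_infty) lf ->
  is_RInt_gen g (at_right 0) (Rbar_locally p_infty) lg ->
  (forall t, 0 < t -> 0 <= f t <= g t) -> lf <= lg.
Proof.
  intros Hf Hg Hfg; apply Rle_trans with (Rabs lf); [apply RRle_abs|].
  apply (RInt_gen_norm (Fa := at_right 0) (Fb := Rbar_locally p_infty) f g lf lg);
    [| |exact Hf|exact Hg].
  - apply (filter_prod_0_infty _ 1 1); [lra|]; intros u v Hu Hv; simpl; lra.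
  - apply (filter_prod_0_infty _ 1 1); [lra|]; intros u v Hu Hv; simpl; intros t Ht.
    change (Rabs (f t) <= g t); rewrite Rabs_right; [|apply Rle_ge]; apply Hfg; lra.
Qed.

Lemma is_RInt_gen_0_infty_derive (F f : R -> R) (la lb : R) :
  (forall t, 0 < t -> is_derive F t (f t)) -> (forall t, 0 < t -> continuous f t) ->
  filterlim F (at_right 0) (locally la) ->
  filterlim F (Rbar_locally p_infty) (locally lb) ->
  is_RInt_gen f (at_right 0) (Rbar_locally p_infty) (lb - la).
Proof.
  intros HF Hf Ha Hb.
  assert (Hpos : forall u v t, 0 < u -> 0 < v -> Rmin u v <= t -> 0 < t).
  { intros u v t Hu Hv Ht; apply Rlt_le_trans with (2 := Ht), Rmin_pos; assumption. }
  apply (is_RInt_gen_ext (Derive F)).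
  - apply (filter_prod_0_infty _ 1 0); [lra|]; intros u v Hu Hv; simpl; intros t Ht.
    apply is_derive_unique, HF, (Hpos u v); lra.
  - apply is_RInt_gen_Derive; [| |exact Ha|exact Hb].
    + apply (filter_prod_0_infty _ 1 0); [lra|]; intros u v Hu Hv; simpl; intros t Ht.
      exists (f t); apply HF, (Hpos u v); lra.
    + apply (filter_prod_0_infty _ 1 0); [lra|]; intros u v Hu Hv; simpl; intros t Ht.
      assert (Ht0 : 0 < t) by (apply (Hpos u v); lra).
      apply (continuous_ext_loc _ f); [|exact (Hf t Ht0)].
      apply filter_imp with (fun y => 0 < y); [|exact (locally_gt 0 t Ht0)].
      intros y Hy; symmetry; apply is_derive_unique, HF, Hy.
Qed.

Definition gamma_integrand (x t : R) : R := Rpower t (x - 1) * exp (- t).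

Lemma Rpower_minus_1 (x t : R) : 0 < t -> Rpower t (x - 1) = Rpower t x / t.
Proof.
  intros Ht; unfold Rminus; rewrite Rpower_plus, Rpower_Ropp, Rpower_1; [reflexivity | exact Ht].
Qed.

Lemma is_derive_Rpower (x t : R) : 0 < t ->
  is_derive (fun t => Rpower t x) t (x * Rpower t (x - 1)).
Proof.
  intros Ht; rewrite Rpower_minus_1 by exact Ht; unfold Rpower.
  auto_derive; [exact Ht | field; lra].
Qed.

Lemma continuous_gamma_integrand (x t : R) :
  0 < t -> continuous (gamma_integrand x) t.
Proof.
  intros Ht; apply (ex_derive_continuous (gamma_integrand x) t).
  unfold gamma_integrand, Rpower; auto_derive; exact Ht.
Qed.

Lemma gamma_integrand_pos (x t : R) : 0 < gamma_integrand x t.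
Proof. apply Rmult_lt_0_compat; apply exp_pos. Qed.

(** From [1 + y <= exp y] at [y = ln (t / (2 x))], with [C = (2 x)^x]. The half exponent leaves
    room: the square of the bound grows like [exp t], and the bound times [exp (- t)] still
    decays. *)
Lemma Rpower_le_exp_half (x : R) : 0 < x ->
  exists C, 0 < C /\ forall t, 0 < t -> Rpower t x <= C * exp (t / 2).
Proof.
  intros Hx; exists (exp (x * ln (2 * x))); split; [apply exp_pos|].
  intros t Ht; unfold Rpower; rewrite <- exp_plus.
  assert (Hr : 0 < t / (2 * x)) by (apply Rdiv_lt_0_compat; lra).
  assert (H := exp_ineq1_le (ln (t / (2 * x)))).
  rewrite exp_ln in H by exact Hr.
  rewrite ln_div in H by lra.
  apply (Rmult_le_compat_l x _ _ ltac:(lra)) in H.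
  replace (x * (t / (2 * x))) with (t / 2) in H by (field; lra).
  destruct (Rle_lt_or_eq_dec (x * ln t) (x * ln (2 * x) + t / 2) ltac:(nra)) as [Hlt|Heq].
  - apply Rlt_le, exp_increasing, Hlt.
  - rewrite Heq; apply Rle_refl.
Qed.

(* [t^x / (1 + t^x)] is bounded and its derivative [x t^(x-1) / (1 + t^x)^2]
   dominates the integrand, near [0] and at infinity alike. *)
Lemma gamma_integrand_RInt_bounded (x : R) : 0 < x ->
  exists M, forall a b, 0 < a <= b -> RInt (gamma_integrand x) a b <= M.
Proof.
  intros Hx; destruct (Rpower_le_exp_half x Hx) as [C [HC HCt]].
  (* Chosen so that domination reduces to [(1 + t^x)^2 <= (1 + C)^2 * exp t]; the division by [x]
     cancels the factor [x] of the derivative. *)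
  set (D := (1 + C) ^ 2 / x).
  assert (HD : 0 < D) by (apply Rdiv_lt_0_compat; [apply pow_lt; lra | exact Hx]).
  exists D; intros a b Hab.
  set (A := fun t => - (D / (1 + Rpower t x))).
  set (A' := fun t => D * (x * Rpower t (x - 1)) / (1 + Rpower t x) ^ 2).
  assert (Hp : forall t, 0 < Rpower t x) by (intros t; apply exp_pos).
  assert (HA : is_RInt A' a b (A b - A a)).
  { apply (is_RInt_derive A A'); rewrite Rmin_left, Rmax_right by lra; intros t Ht.
    - unfold A, A'; specialize (Hp t).
      assert (Hd := is_derive_Rpower x t ltac:(lra)).
      assert (Hd' : is_derive (fun p => - (D / (1 + p))) (Rpower t x) (D / (1 + Rpower t x) ^ 2)).
      { auto_derive; [lra | field; lra]. }
      assert (H := is_derive_comp (fun p => - (D / (1 + p))) (fun t => Rpower t x) t _ _ Hd' Hd).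
      replace (D * (x * Rpower t (x - 1)) / (1 + Rpower t x) ^ 2)
        with (scal (x * Rpower t (x - 1)) (D / (1 + Rpower t x) ^ 2)); [exact H|].
      change (x * Rpower t (x - 1) * (D / (1 + Rpower t x) ^ 2)
        = D * (x * Rpower t (x - 1)) / (1 + Rpower t x) ^ 2); field; lra.
    - apply (ex_derive_continuous A' t); unfold A'; specialize (Hp t).
      unfold Rpower in *; auto_derive.
      repeat split; try lra; apply Rgt_not_eq; nra. }
  apply Rle_trans with (A b - A a).
  - apply (is_RInt_le (gamma_integrand x) A' a b); [lra| |exact HA|].
    + apply (RInt_correct (gamma_integrand x)), (ex_RInt_continuous (gamma_integrand x)).
      rewrite Rmin_left, Rmax_right by lra; intros t Ht; apply continuous_gamma_integrand; lra.
    + intros t Ht; unfold gamma_integrand, A'.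
      specialize (Hp t); specialize (HCt t ltac:(lra)).
      assert (He : 1 <= exp (t / 2)) by (generalize (exp_ineq1_le (t / 2)); lra).
      assert (Hq : (1 + Rpower t x) ^ 2 <= (1 + C) ^ 2 * exp t).
      { replace t with (t / 2 + t / 2) at 2 by field; rewrite exp_plus.
        replace ((1 + C) ^ 2 * (exp (t / 2) * exp (t / 2))) with (((1 + C) * exp (t / 2)) ^ 2) by ring.
        apply pow_incr; nra. }
      replace (D * (x * Rpower t (x - 1)) / (1 + Rpower t x) ^ 2)
        with (Rpower t (x - 1) * ((1 + C) ^ 2 / (1 + Rpower t x) ^ 2))
        by (unfold D; field; lra).
      apply Rmult_le_compat_l; [apply Rlt_le, exp_pos|].
      rewrite exp_Ropp; assert (Het := exp_pos t).
      apply Rmult_le_reg_r with ((1 + Rpower t x) ^ 2); [apply pow_lt; lra|].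
      replace ((1 + C) ^ 2 / (1 + Rpower t x) ^ 2 * (1 + Rpower t x) ^ 2) with ((1 + C) ^ 2)
        by (field; lra).
      apply Rmult_le_reg_l with (exp t); [exact Het|].
      rewrite <- Rmult_assoc, Rinv_r, Rmult_1_l by lra; lra.
  - unfold A; assert (Hb := Hp b); assert (Ha := Hp a).
    assert (0 <= D / (1 + Rpower b x)) by (apply Rlt_le, Rdiv_lt_0_compat; lra).
    assert (D / (1 + Rpower a x) <= D); [|lra].
    apply Rmult_le_reg_r with (1 + Rpower a x); [lra|].
    unfold Rdiv; rewrite Rmult_assoc, Rinv_l by lra; nra.
Qed.

Lemma Gamma_correct (x : R) : 0 < x ->
  is_RInt_gen (gamma_integrand x) (at_right 0) (Rbar_locally p_infty) (Gamma x)
  /\ 0 < Gamma x.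
Proof.
  intros Hx; destruct (gamma_integrand_RInt_bounded x Hx) as [M HM].
  destruct (RInt_gen_of_bounded (gamma_integrand x) M) as [L [HL HLe]].
  - apply continuous_gamma_integrand.
  - intros t _; apply Rlt_le, gamma_integrand_pos.
  - exact HM.
  - assert (E : Gamma x = L) by exact (is_RInt_gen_unique _ _ HL).
    rewrite E; split; [exact HL|].
    apply Rlt_le_trans with (2 := HLe 1 2 ltac:(lra)).
    apply RInt_gt_0; [lra | |].
    + intros t _; apply gamma_integrand_pos.
    + intros t Ht; apply continuous_gamma_integrand; lra.
Qed.

Lemma filterlim_Rpower_exp_0 (x : R) : 0 < x ->
  filterlim (fun t => Rpower t x * exp (- t)) (at_right 0) (locally 0).
Proof.
  intros Hx; apply filterlim_locally; intros eps.
  assert (Hd : 0 < Rpower eps (/ x)) by apply exp_pos.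
  exists (mkposreal _ Hd); intros t Ht Ht0.
  change (Rabs (t - 0) < Rpower eps (/ x)) in Ht; apply Rabs_def2 in Ht.
  change (Rabs (Rpower t x * exp (- t) - 0) < eps).
  assert (H : Rpower t x < eps).
  { replace (pos eps) with (Rpower (Rpower eps (/ x)) x).
    - apply Rlt_Rpower_l; lra.
    - rewrite Rpower_mult, Rinv_l by lra; apply Rpower_1, cond_pos. }
  assert (Hp : 0 < Rpower t x) by apply exp_pos.
  assert (He : 0 < exp (- t)) by apply exp_pos.
  assert (exp (- t) < 1) by (rewrite <- exp_0; apply exp_increasing; lra).
  apply Rabs_def1; nra.
Qed.

Lemma filterlim_Rpower_exp_infty (x : R) : 0 < x ->
  filterlim (fun t => Rpower t x * exp (- t)) (Rbar_locally p_infty) (locally 0).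
Proof.
  intros Hx; apply filterlim_locally; intros eps.
  destruct (Rpower_le_exp_half x Hx) as [C [HC HCt]].
  exists (Rmax 0 (- 2 * ln (eps / C))); intros t Ht.
  assert (Ht0 : 0 < t) by (apply Rle_lt_trans with (2 := Ht), Rmax_l).
  assert (Ht1 : - 2 * ln (eps / C) < t) by (apply Rle_lt_trans with (2 := Ht), Rmax_r).
  change (Rabs (Rpower t x * exp (- t) - 0) < eps).
  assert (Hp : 0 < Rpower t x * exp (- t)) by (apply Rmult_lt_0_compat; apply exp_pos).
  apply Rabs_def1; [|generalize (cond_pos eps); lra].
  rewrite Rminus_0_r; apply Rle_lt_trans with (C * exp (t / 2) * exp (- t)).
  - apply Rmult_le_compat_r; [apply Rlt_le, exp_pos | apply HCt, Ht0].
  - rewrite Rmult_assoc, <- exp_plus.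
    replace (t / 2 + - t) with (- t / 2) by field.
    replace (pos eps) with (C * exp (ln (eps / C))).
    + apply Rmult_lt_compat_l; [exact HC | apply exp_increasing; lra].
    + rewrite exp_ln; [field; lra | apply Rdiv_lt_0_compat; [apply cond_pos | exact HC]].
Qed.

(** Integration by parts in one piece: [f] is the derivative of [t^x * exp (- t)], which tends to 0
    at both ends. *)
Lemma Gamma_plus_1 (x : R) : 0 < x -> Gamma (x + 1) = x * Gamma x.
Proof.
  intros Hx.
  destruct (Gamma_correct x Hx) as [H0 _], (Gamma_correct (x + 1) ltac:(lra)) as [H1 _].
  set (f := fun t => x * gamma_integrand x t - gamma_integrand (x + 1) t).
  assert (Hf : is_RInt_gen f (at_right 0) (Rbar_locally p_infty) (0 - 0)).
  { apply (is_RInt_gen_0_infty_derive (fun t => Rpower t x * exp (- t))).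
    - intros t Ht.
      replace (f t) with (plus (mult (x * Rpower t (x - 1)) (exp (- t)))
        (mult (Rpower t x) (- exp (- t)))).
      + apply (is_derive_mult (fun t => Rpower t x) (fun t => exp (- t)) t);
          [apply is_derive_Rpower, Ht | auto_derive; [exact I | ring] | exact Rmult_comm].
      + unfold f, gamma_integrand, plus, mult; simpl.
        replace (x + 1 - 1) with x by ring; ring.
    - intros t Ht; apply (continuous_minus (fun t => x * gamma_integrand x t)).
      + apply (continuous_scal_r x (gamma_integrand x)), continuous_gamma_integrand, Ht.
      + apply continuous_gamma_integrand, Ht.
    - apply filterlim_Rpower_exp_0, Hx.
    - apply filterlim_Rpower_exp_infty, Hx. }
  assert (Hg := is_RInt_gen_minus _ _ _ _ (is_RInt_gen_scal _ x _ H0) H1).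
  assert (E : x * Gamma x - Gamma (x + 1) = 0 - 0).
  { rewrite <- (is_RInt_gen_unique f _ Hf); symmetry; exact (is_RInt_gen_unique f _ Hg). }
  lra.
Qed.

Lemma Gamma_1 : Gamma 1 = 1.
Proof.
  destruct (Gamma_correct 1 Rlt_0_1) as [H _].
  assert (Hf : is_RInt_gen (gamma_integrand 1) (at_right 0) (Rbar_locally p_infty) (0 - (- 1))).
  { apply (is_RInt_gen_0_infty_derive (fun t => - exp (- t))).
    - intros t Ht; unfold gamma_integrand; replace (1 - 1) with 0 by ring.
      rewrite Rpower_O by exact Ht; auto_derive; [exact I | ring].
    - intros t Ht; apply continuous_gamma_integrand, Ht.
    - replace (- 1) with (- exp (- 0)) by (rewrite Ropp_0, exp_0; reflexivity).
      apply (filterlim_filter_le_1 (F := locally 0)); [apply filter_le_within|].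
      apply (ex_derive_continuous (fun t => - exp (- t))); auto_derive; exact I.
    - apply filterlim_locally; intros eps.
      exists (- ln eps); intros t Ht; change (Rabs (- exp (- t) - 0) < eps).
      assert (Hp := exp_pos (- t)).
      assert (exp (- t) < eps).
      { rewrite <- (exp_ln eps) by apply cond_pos; apply exp_increasing; lra. }
      apply Rabs_def1; lra. }
  assert (E := is_RInt_gen_unique _ _ Hf).
  rewrite (is_RInt_gen_unique _ _ H) in E; lra.
Qed.

(** The tangent line of [exp] at [s * y], evaluated at [y] and at 0, with weights [s] and [1 - s]:
    the linear terms cancel. *)
Lemma exp_convex_0 (s y : R) : 0 <= s <= 1 -> exp (s * y) <= (1 - s) + s * exp y.
Proof.
  intros Hs.
  assert (H1 := exp_ineq1_le ((1 - s) * y)); assert (H2 := exp_ineq1_le (- (s * y))).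
  assert (E1 : exp y = exp (s * y) * exp ((1 - s) * y))
    by (rewrite <- exp_plus; f_equal; ring).
  assert (E2 : 1 = exp (s * y) * exp (- (s * y)))
    by (rewrite <- exp_plus, Rplus_opp_r, exp_0; reflexivity).
  assert (Hv := exp_pos (s * y)).
  apply (Rmult_le_compat_l _ _ _ (Rlt_le _ _ Hv)) in H1; rewrite <- E1 in H1.
  apply (Rmult_le_compat_l _ _ _ (Rlt_le _ _ Hv)) in H2; rewrite <- E2 in H2.
  apply (Rmult_le_compat_l s _ _ ltac:(lra)) in H1.
  apply (Rmult_le_compat_l (1 - s) _ _ ltac:(lra)) in H2.
  nra.
Qed.

(* The tangent line at [t = a] dominates [t^s]; integrating it against
   [t^(a-1) exp (-t)] replaces Hoelder's inequality. *)
Lemma Gamma_plus_le (a s : R) : 0 < a -> 0 <= s <= 1 ->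
  Gamma (a + s) <= Rpower a s * Gamma a.
Proof.
  intros Ha Hs.
  destruct (Gamma_correct a Ha) as [H0 _], (Gamma_correct (a + 1) ltac:(lra)) as [H1 _],
    (Gamma_correct (a + s) ltac:(lra)) as [H2 _].
  assert (Hg := is_RInt_gen_scal _ (Rpower a s) _ (is_RInt_gen_plus _ _ _ _
    (is_RInt_gen_scal _ (1 - s) _ H0) (is_RInt_gen_scal _ (s / a) _ H1))).
  replace (Rpower a s * Gamma a)
    with (Rpower a s * ((1 - s) * Gamma a + s / a * Gamma (a + 1)))
    by (rewrite Gamma_plus_1 by exact Ha; field; lra).
  apply (RInt_gen_0_infty_le _ _ _ _ H2 Hg); intros t Ht; split.
  - apply Rlt_le, gamma_integrand_pos.
  - change (gamma_integrand (a + s) t <= Rpower a s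
      * ((1 - s) * gamma_integrand a t + s / a * gamma_integrand (a + 1) t)).
    unfold gamma_integrand.
    replace (a + s - 1) with ((a - 1) + s) by ring.
    replace (a + 1 - 1) with ((a - 1) + 1) by ring.
    rewrite !Rpower_plus, Rpower_1 by exact Ht.
    assert (Hw : 0 < Rpower t (a - 1) * exp (- t)) by (apply Rmult_lt_0_compat; apply exp_pos).
    replace (Rpower t (a - 1) * Rpower t s * exp (- t))
      with (Rpower t (a - 1) * exp (- t) * Rpower t s) by ring.
    replace (Rpower a s * ((1 - s) * (Rpower t (a - 1) * exp (- t))
        + s / a * (Rpower t (a - 1) * t * exp (- t))))
      with (Rpower t (a - 1) * exp (- t) * (Rpower a s * ((1 - s) + s * (t / a)))) by (field; lra).
    apply Rmult_le_compat_l; [lra|].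
    assert (Hr : 0 < t / a) by (apply Rdiv_lt_0_compat; lra).
    assert (H := exp_convex_0 s (ln (t / a)) Hs); rewrite exp_ln in H by exact Hr.
    replace (Rpower t s) with (Rpower a s * Rpower (t / a) s).
    + apply Rmult_le_compat_l; [apply Rlt_le, exp_pos | exact H].
    + rewrite Rpower_mult_distr by assumption; f_equal; field; lra.
Qed.

(** * Weierstrass' product *)

Lemma Gamma_pos (x : R) : 0 < x -> 0 < Gamma x.
Proof. intros Hx; apply Gamma_correct, Hx. Qed.

Lemma ln_Gamma_plus_le (a s : R) : 0 < a -> 0 <= s <= 1 ->
  ln (Gamma (a + s)) <= s * ln a + ln (Gamma a).
Proof.
  intros Ha Hs.
  assert (H := Gamma_plus_le a s Ha Hs).
  assert (H1 := Gamma_pos (a + s) ltac:(lra)); assert (H2 := Gamma_pos a Ha).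
  apply ln_le in H; [|exact H1].
  rewrite ln_mult in H; [|apply exp_pos | exact H2].
  unfold Rpower in H; rewrite ln_exp in H; exact H.
Qed.

Lemma ln_Gamma_plus_1 (a : R) : 0 < a -> ln (Gamma (a + 1)) = ln a + ln (Gamma a).
Proof.
  intros Ha; rewrite Gamma_plus_1 by exact Ha; apply ln_mult; [exact Ha | apply Gamma_pos, Ha].
Qed.

Lemma is_lim_seq_ln_shift (c : R) :
  is_lim_seq (fun n => ln (INR n + c) - ln (INR n)) 0.
Proof.
  rewrite <- ln_1.
  apply (is_lim_seq_ext_loc (fun n => ln (1 + c * / INR n))).
  - destruct (INR_unbounded (Rmax 0 (- c))) as [N HN]; exists N; intros n Hn.
    assert (HnN : INR N <= INR n) by (apply le_INR; lia).
    assert (H0 := Rmax_l 0 (- c)); assert (H1 := Rmax_r 0 (- c)).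
    rewrite <- ln_div by lra; f_equal; field; lra.
  - apply (is_lim_seq_continuous ln (fun n => 1 + c * / INR n)).
    + apply (is_derive_continuity_pt ln 1 (/ 1)), is_derive_ln; lra.
    + replace (Finite 1) with (Finite (1 + c * 0)) by (f_equal; ring).
      apply (is_lim_seq_plus' (fun _ => 1)); [apply is_lim_seq_const|].
      apply (is_lim_seq_scal_l (fun n => / INR n) c 0).
      apply (is_lim_seq_inv INR p_infty); [apply is_lim_seq_INR | discriminate].
Qed.

(** The logarithmic form of Euler's asymptotics, [Gamma (n + 1 + x)] equivalent to [n! * n^x]. *)
Definition Gamma_ratio_limit (x : R) : Prop :=
  is_lim_seq (fun n => ln (Gamma (INR n + 1 + x)) - ln (Gamma (INR n + 1)) - x * ln (INR n)) 0.

(** [ln_Gamma_plus_le] gives both sides: the upper one by a step [s] from [n + 1], the lower one by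
    the complementary step [1 - s] from [n + 1 + s], which ends at [n + 2]. *)
Lemma Gamma_ratio_limit_01 (s : R) : 0 <= s <= 1 -> Gamma_ratio_limit s.
Proof.
  intros Hs.
  apply (is_lim_seq_le_le
    (fun n => (ln (INR n + 1) - ln (INR n)) - (1 - s) * (ln (INR n + (1 + s)) - ln (INR n))) _
    (fun n => s * (ln (INR n + 1) - ln (INR n)))).
  - intros n; assert (Hn := pos_INR n); split.
    + assert (H := ln_Gamma_plus_le (INR n + 1 + s) (1 - s) ltac:(lra) ltac:(lra)).
      replace (INR n + 1 + s + (1 - s)) with (INR n + 1 + 1) in H by ring.
      rewrite ln_Gamma_plus_1 in H by lra.
      replace (INR n + (1 + s)) with (INR n + 1 + s) by ring; lra.
    + assert (H := ln_Gamma_plus_le (INR n + 1) s ltac:(lra) Hs); lra.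
  - replace (Finite 0) with (Finite (0 - (1 - s) * 0)) by (f_equal; ring).
    apply is_lim_seq_minus'; [apply is_lim_seq_ln_shift|].
    apply (is_lim_seq_scal_l _ (1 - s) 0), is_lim_seq_ln_shift.
  - replace (Finite 0) with (Finite (s * 0)) by (f_equal; ring).
    apply (is_lim_seq_scal_l _ s 0), is_lim_seq_ln_shift.
Qed.

Lemma Gamma_ratio_limit_step (x : R) : -1 < x ->
  Gamma_ratio_limit x <-> Gamma_ratio_limit (x + 1).
Proof.
  intros Hx.
  assert (E : forall n, ln (Gamma (INR n + 1 + (x + 1))) - ln (Gamma (INR n + 1)) - (x + 1) * ln (INR n)
    = (ln (Gamma (INR n + 1 + x)) - ln (Gamma (INR n + 1)) - x * ln (INR n))
      + (ln (INR n + (1 + x)) - ln (INR n))).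
  { intros n; assert (Hn := pos_INR n).
    replace (INR n + 1 + (x + 1)) with (INR n + 1 + x + 1) by ring.
    rewrite ln_Gamma_plus_1 by lra.
    replace (INR n + (1 + x)) with (INR n + 1 + x) by ring; ring. }
  assert (L := is_lim_seq_ln_shift (1 + x)).
  unfold Gamma_ratio_limit; split; intros H.
  - apply (is_lim_seq_ext _ _ _ (fun n => eq_sym (E n))).
    replace (Finite 0) with (Finite (0 + 0)) by (f_equal; ring).
    apply is_lim_seq_plus'; assumption.
  - replace (Finite 0) with (Finite (0 - 0)) by (f_equal; ring).
    apply (is_lim_seq_ext (fun n =>
      (ln (Gamma (INR n + 1 + (x + 1))) - ln (Gamma (INR n + 1)) - (x + 1) * ln (INR n))
      - (ln (INR n + (1 + x)) - ln (INR n)))).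
    + intros n; rewrite E; ring.
    + apply is_lim_seq_minus'; assumption.
Qed.

(** Both directions of the step are used: downwards from [0, 1] to [x <= 0], upwards for positive
    [x] by induction on an integer bound. *)
Lemma Gamma_ratio_limit_all (x : R) : -1 < x -> Gamma_ratio_limit x.
Proof.
  intros Hx; destruct (INR_unbounded x) as [m Hm]; revert x Hx Hm.
  induction m as [|m IH]; intros x Hx Hm.
  - simpl in Hm; apply Gamma_ratio_limit_step; [exact Hx|].
    apply Gamma_ratio_limit_01; lra.
  - destruct (Rle_lt_dec x 0) as [H0|H0].
    + apply Gamma_ratio_limit_step; [exact Hx|]; apply Gamma_ratio_limit_01; lra.
    + replace x with (x - 1 + 1) by ring; apply (Gamma_ratio_limit_step (x - 1)); [lra|].
      rewrite S_INR in Hm; apply IH; lra.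
Qed.

Lemma ln_Gamma_shift (x : R) (n : nat) : -1 < x ->
  ln (Gamma (INR (S n) + 1 + x)) = ln (Gamma (x + 1)) + sum_n (fun k => ln (INR (S k) + x)) n.
Proof.
  intros Hx; induction n as [|n IH].
  - rewrite sum_O; simpl INR; replace (1 + 1 + x) with (x + 1 + 1) by ring.
    rewrite ln_Gamma_plus_1 by lra; replace (1 + x) with (x + 1) by ring; ring.
  - rewrite sum_Sn; assert (Hn := pos_INR n).
    rewrite (S_INR (S n)) at 1.
    replace (INR (S n) + 1 + 1 + x) with (INR (S n) + 1 + x + 1) by ring.
    rewrite ln_Gamma_plus_1 by (rewrite S_INR; lra).
    rewrite IH; unfold plus; simpl plus; rewrite (S_INR (S n)); simpl; ring.
Qed.

(** The factor [x] provides the antiderivative [A] in [u], valid at [x = 0] as well. *)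
Lemma mult_ikern_0 (k : nat) (x : R) : -1 < x ->
  x * ikern O k x = x / INR (S k) - (ln (INR (S k) + x) - ln (INR (S k))).
Proof.
  intros Hx.
  assert (H : is_RInt (fun u => x * kern O k u x) 0 1 (x * ikern O k x))
    by (apply (is_RInt_scal (fun u => kern O k u x)), is_RInt_ikern, Hx).
  set (A := fun u => u * x / INR (S k) - ln (INR (S k) + u * x)).
  assert (HK : 0 < INR (S k)) by (rewrite S_INR; generalize (pos_INR k); lra).
  assert (HA : is_RInt (fun u => x * kern O k u x) 0 1 (A 1 - A 0)).
  { apply (is_RInt_derive A (fun u => x * kern O k u x));
      rewrite Rmin_left, Rmax_right by lra; intros u Hu; assert (Hb := base_pos x u k Hx Hu).
    - unfold A, kern; revert HK Hb; generalize (INR (S k)); intros K HK Hb.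
      auto_derive; [exact Hb | simpl; field; lra].
    - apply (ex_derive_continuous (fun u => x * kern O k u x)).
      unfold kern; revert HK Hb; generalize (INR (S k)); intros K HK Hb.
      auto_derive; lra. }
  rewrite <- (is_RInt_unique _ _ _ _ H), (is_RInt_unique _ _ _ _ HA); unfold A.
  rewrite Rmult_1_l, Rmult_0_l, Rplus_0_r; field; lra.
Qed.

Definition harmonic_minus_ln (n : nat) : R := sum_n_m (fun k => / INR k) 1 n - ln (INR n).

(** Weierstrass' product before the limit, as an exact identity; the last parenthesis is the term of
    [Gamma_ratio_limit] at index [S n]. *)
Lemma product_partial_sum (x : R) (n : nat) : -1 < x ->
  sum_n (fun k => x * ikern O k x) n
  = ln (Gamma (x + 1)) + x * harmonic_minus_ln (S n)
    - (ln (Gamma (INR (S n) + 1 + x)) - ln (Gamma (INR (S n) + 1)) - x * ln (INR (S n))).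
Proof.
  intros Hx; unfold harmonic_minus_ln.
  assert (E1 := ln_Gamma_shift x n Hx); assert (E0 := ln_Gamma_shift 0 n ltac:(lra)).
  rewrite Rplus_0_r, Rplus_0_l, Gamma_1, ln_1 in E0; rewrite E1, E0; clear E0 E1.
  rewrite <- (sum_n_m_S (fun k => / INR k) O n).
  change (sum_n_m (fun k => / INR (S k)) O n) with (sum_n (fun k => / INR (S k)) n).
  induction n as [|n IH].
  - rewrite !sum_O, mult_ikern_0 by exact Hx; rewrite Rplus_0_r.
    simpl; field.
  - rewrite !sum_Sn, mult_ikern_0 by exact Hx; unfold plus; simpl plus.
    rewrite Rplus_0_r; unfold Rdiv; revert IH; simpl; intros IH; lra.
Qed.

(** At [x = 1], where [ln (Gamma 2) = 0], the finite product formula expresses this sequence by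
    partial sums of a convergent series and a null sequence. This shows that the limit defining
    [Euler_Mascheroni] exists. *)
Lemma harmonic_minus_ln_lim : is_lim_seq harmonic_minus_ln Euler_Mascheroni.
Proof.
  assert (H : ex_finite_lim_seq harmonic_minus_ln).
  { assert (HS := Series_correct _ (ex_series_ikern O 1 ltac:(lra))).
    exists (Series (fun k => ikern O k 1) + 0); apply is_lim_seq_incr_1.
    apply (is_lim_seq_ext (fun n => sum_n (fun k => ikern O k 1) n
      + (ln (Gamma (INR (S n) + 1 + 1)) - ln (Gamma (INR (S n) + 1)) - 1 * ln (INR (S n))))).
    - intros n.
      rewrite (sum_n_ext (fun k => ikern O k 1) (fun k => 1 * ikern O k 1))
        by (intros k; symmetry; apply Rmult_1_l).
      rewrite product_partial_sum by lra.
      rewrite (Gamma_plus_1 1), Gamma_1, Rmult_1_l, ln_1 by lra; ring.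
    - apply is_lim_seq_plus'; [exact HS|].
      apply (is_lim_seq_incr_1 (fun n => ln (Gamma (INR n + 1 + 1)) - ln (Gamma (INR n + 1))
        - 1 * ln (INR n))).
      apply Gamma_ratio_limit_all; lra. }
  destruct H as [l Hl]; unfold Euler_Mascheroni.
  change (fun n => sum_n_m (fun k => / INR k) 1 n - ln (INR n)) with harmonic_minus_ln.
  rewrite (is_lim_seq_unique _ _ Hl); exact Hl.
Qed.

Lemma ln_Gamma_eq (x : R) : -1 < x -> ln (Gamma (x + 1)) = x * phi O x.
Proof.
  intros Hx.
  assert (HS := is_series_scal_l x _ _ (Series_correct _ (ex_series_ikern O x Hx))).
  assert (HL : is_lim_seq (sum_n (fun k => x * ikern O k x))
    (ln (Gamma (x + 1)) + x * Euler_Mascheroni - 0)).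
  { apply (is_lim_seq_ext _ _ _ (fun n => eq_sym (product_partial_sum x n Hx))).
    apply is_lim_seq_minus'.
    - apply (is_lim_seq_plus' (fun _ => ln (Gamma (x + 1)))); [apply is_lim_seq_const|].
      apply (is_lim_seq_scal_l (fun n => harmonic_minus_ln (S n)) x Euler_Mascheroni).
      apply (is_lim_seq_incr_1 harmonic_minus_ln), harmonic_minus_ln_lim.
    - apply (is_lim_seq_incr_1 (fun n => ln (Gamma (INR n + 1 + x)) - ln (Gamma (INR n + 1))
        - x * ln (INR n))).
      apply Gamma_ratio_limit_all, Hx. }
  assert (E : ln (Gamma (x + 1)) + x * Euler_Mascheroni - 0 = x * Series (fun k => ikern O k x)).
  { rewrite <- (is_series_unique _ _ HL); exact (is_series_unique _ _ HS). }
  unfold phi; lra.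
Qed.

Lemma Gamma_root_eq (x : R) : -1 < x -> Gamma_root x = exp (phi O x).
Proof.
  intros Hx; unfold Gamma_root; destruct (Req_EM_T x 0) as [->|Hne].
  - f_equal; unfold phi.
    (* The kernel vanishes at [x = 0], which leaves [- gamma]; the form [0 * 0] lets [Series_scal_l]
       evaluate the zero series. *)
    rewrite (Series_ext _ (fun _ => 0 * 0)), Series_scal_l; [ring|].
    intros k; rewrite Rmult_0_l; apply is_RInt_unique.
    assert (H : is_RInt (fun _ : R => 0) 0 1 ((1 - 0) * 0)) by exact (is_RInt_const 0 1 0).
    rewrite Rmult_0_r in H.
    assert (E : forall u, 0 = kern O k u 0).
    { intros u; unfold kern; rewrite Rmult_0_r, Rplus_0_r.
      assert (HK : 0 < INR (S k)) by (rewrite S_INR; generalize (pos_INR k); lra).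
      revert HK; generalize (INR (S k)); intros K HK; simpl; field; lra. }
    apply (is_RInt_ext (fun _ => 0)); [intros u _; apply E | exact H].
  - unfold Rpower; rewrite ln_Gamma_eq by exact Hx; f_equal; field; exact Hne.
Qed.

(** * Sign conditions *)

Definition log_tower (c : R) (n : nat) (x : R) : R :=
  match n with
  | O => ln (x + c)
  | S p => (-1) ^ p * INR (fact p) / (x + c) ^ S p
  end.

Lemma log_tower_tower (c : R) : tower (- c) (log_tower c).
Proof.
  intros [|p] x Hx; unfold log_tower.
  - auto_derive; [lra | simpl; field; lra].
  - assert (0 < (x + c) ^ p) by (apply pow_lt; lra).
    auto_derive; [apply Rgt_not_eq, Rmult_lt_0_compat; lra|].
    change (fact (S p)) with (S p * fact p)%nat; rewrite mult_INR.
    change (match p with O => 1 | S _ => INR p + 1 end) with (INR (S p)).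
    simpl pow; field; lra.
Qed.

Lemma log_tower_sign (c x : R) (p : nat) :
  (-1) ^ p * log_tower c (S p) x = INR (fact p) / (x + c) ^ S p.
Proof.
  assert (E : (-1) ^ p * (-1) ^ p = 1).
  { rewrite <- Rpow_mult_distr; replace (-1 * -1) with 1 by ring; apply pow1. }
  unfold log_tower, Rdiv; rewrite <- !Rmult_assoc, E; ring.
Qed.

(** Strictness comes from the bound with [tau0]: a positive quantity is at most [1 + tau0] times
    this one. *)
Lemma phi_S_pos (p : nat) (x : R) : -1 < x -> 0 < (-1) ^ p * phi (S p) x.
Proof.
  intros Hx; destruct (phi_S_bounds p x Hx) as [_ H].
  assert (0 < INR (fact p) / (x + 1) ^ S p)
    by (apply Rdiv_lt_0_compat; [apply INR_fact_lt_0 | apply pow_lt; lra]).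
  generalize tau0_pos; nra.
Qed.

Lemma phi_1_decr (x y : R) : -1 < x < y -> phi 1 y < phi 1 x.
Proof.
  intros Hxy; destruct (MVT_gen (phi 1) x y (phi 2)) as [c [Hc E]];
    rewrite Rmin_left, Rmax_right in * by lra.
  - intros z Hz; apply phi_tower; lra.
  - intros z Hz; apply (is_derive_continuity_pt _ _ (phi 2 z)), phi_tower; lra.
  - assert (H := phi_S_pos 1 c ltac:(lra)); simpl pow in H; nra.
Qed.

(** For negative [alpha], the point [1 - alpha] puts both arguments, [1] and [1 - alpha], where
    [phi] represents [Gamma_root]. There the logarithmic derivative is
    [phi 1 1 - phi 1 (1 - alpha)], positive because [phi 1] strictly decreases. *)
Lemma alpha_nonneg_of_lcm (alpha : R) :
  log_completely_monotonic (fun x => -1 < x)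
    (fun x => Gamma_root (x + alpha) / Gamma_root x) -> 0 <= alpha.
Proof.
  intros [_ [_ H]]; apply Rnot_lt_le; intros Ha.
  specialize (H 1%nat (1 - alpha) ltac:(lia) ltac:(lra)).
  assert (D : is_derive (fun y => ln (Gamma_root (y + alpha) / Gamma_root y)) (1 - alpha)
    (1 * phi 1 (1 - alpha + alpha) + -1 * phi 1 (1 - alpha))).
  { assert (T : tower (-1 - alpha) (fun n x => 1 * phi n (x + alpha) + -1 * phi n x)).
    { apply (tower_lin _ 1 (-1) (fun n x => phi n (x + alpha)) phi).
      - apply (tower_shift (-1)); [lra | exact phi_tower].
      - apply (tower_weaken (-1)); [lra | exact phi_tower]. }
    apply (is_derive_ext_loc (fun x => 1 * phi O (x + alpha) + -1 * phi O x)).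
    - apply filter_imp with (fun y => -1 - alpha < y); [|apply locally_gt; lra].
      intros y Hy; rewrite !Gamma_root_eq by lra.
      unfold Rdiv; rewrite <- exp_Ropp, <- exp_plus, ln_exp.
      change (1 * phi O (y + alpha) + -1 * phi O y = phi O (y + alpha) + - phi O y :> R); ring.
    - apply (T O); lra. }
  apply is_derive_unique in D.
  change (0 <= (-1) ^ 1 * Derive (fun y => ln (Gamma_root (y + alpha) / Gamma_root y))
    (1 - alpha)) in H.
  change (Derive (fun y : R => ln (Gamma_root (y + alpha) / Gamma_root y)) (1 - alpha)
    = 1 * phi 1 (1 - alpha + alpha) + -1 * phi 1 (1 - alpha) :> R) in D.
  rewrite D in H.
  replace (1 - alpha + alpha) with 1 in H by ring.
  assert (H1 := phi_1_decr 1 (1 - alpha) ltac:(lra)).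
  simpl pow in H; lra.
Qed.

(** A common reduction for all positive assertions: [s] is 1 for a quotient and -1 for its
    reciprocal, and [c] is 1 or 0 according to the logarithmic factor. *)
Lemma lcm_of_signs (a alpha beta c s : R) (f : R -> R) :
  -1 <= a -> - c <= a -> 0 < beta ->
  (forall p x, a < x ->
     0 <= s * (alpha * (INR (fact p) / (x + c) ^ S p) - (-1) ^ p * phi (S p) x)) ->
  (forall x, a < x ->
     f x = exp (s * (phi O x - phi O (x + beta) + alpha * (ln (x + beta + c) - ln (x + c))))) ->
  log_completely_monotonic (fun x => a < x) f.
Proof.
  intros Ha Hc Hb Hs Hf.
  apply (lcm_of_tower _ beta (fun n x => s * phi n x + - s * alpha * log_tower c n x));
    [|exact Hb| |].
  - apply (tower_lin _ s (- s * alpha) phi (log_tower c)).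
    + apply (tower_weaken (-1)); [exact Ha | exact phi_tower].
    + apply (tower_weaken (- c)); [exact Hc | apply log_tower_tower].
  - intros [|p] x Hn Hx; [lia|].
    assert (H := Hs p x Hx); rewrite <- log_tower_sign in H.
    simpl pow; simpl pow in H; lra.
  - intros x Hx; rewrite (Hf x Hx); f_equal; simpl; ring.
Qed.

Lemma Gamma_root_quotient_eq (alpha beta c x : R) : -1 < x -> 0 < x + c -> 0 < beta ->
  Gamma_root x / Gamma_root (x + beta) * Rpower (1 + beta / (x + c)) alpha
  = exp (phi O x - phi O (x + beta) + alpha * (ln (x + beta + c) - ln (x + c))).
Proof.
  intros Hx Hc Hb; rewrite !Gamma_root_eq by lra.
  replace (1 + beta / (x + c)) with ((x + beta + c) / (x + c)) by (field; lra).
  unfold Rpower; rewrite ln_div by lra.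
  unfold Rdiv; rewrite <- exp_Ropp, <- !exp_plus; f_equal; ring.
Qed.

Theorem proposition1 :
  (* (a) *)
  (forall alpha : R, alpha <> 0 ->
    (log_completely_monotonic (fun x => -1 < x)
       (fun x => Gamma_root (x + alpha) / Gamma_root x)
     <-> 0 < alpha))
  /\
  (* (b) *)
  ((forall alpha beta : R, 1 <= alpha -> 0 < beta ->
     log_completely_monotonic (fun x => -1 < x)
       (fun x => Gamma_root x / Gamma_root (x + beta)
                 * Rpower (1 + beta / (x + 1)) alpha))
   /\
   1 / (1 + tau0) < 1
   /\
   (forall alpha beta : R, 0 < beta -> alpha <= 1 / (1 + tau0) ->
     log_completely_monotonic (fun x => -1 < x)
       (fun x => / (Gamma_root x / Gamma_root (x + beta)
                    * Rpower (1 + beta / (x + 1)) alpha))))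
  /\
  (* (c) *)
  ((forall alpha beta : R, 1 <= alpha -> 0 < beta ->
     log_completely_monotonic (fun x => 0 < x)
       (fun x => Gamma_root x / Gamma_root (x + beta)
                 * Rpower (1 + beta / x) alpha))
   /\
   (forall alpha beta : R, alpha <= 0 -> 0 < beta ->
     log_completely_monotonic (fun x => 0 < x)
       (fun x => / (Gamma_root x / Gamma_root (x + beta)
                    * Rpower (1 + beta / x) alpha)))).
Proof.
  assert (He : forall p y, 0 < y -> 0 < INR (fact p) / y ^ S p).
  { intros p y Hy; apply Rdiv_lt_0_compat; [apply INR_fact_lt_0 | apply pow_lt, Hy]. }
  assert (Ht := tau0_pos).
  split; [|split; [split; [|split]|split]].
  - intros alpha Hne; split.
    (* At [alpha = 0] the function is the constant 1, which passes the test; [Hne] excludes it. *)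
    + intros H; destruct (alpha_nonneg_of_lcm alpha H) as [Hlt|Heq];
        [exact Hlt | symmetry in Heq; contradiction].
    (* The shift is [alpha] itself and the logarithm has coefficient 0, so the positivity of the
       signed derivatives of [phi] suffices. *)
    + intros Ha; apply (lcm_of_signs _ 0 alpha 1 (-1)); [lra|lra|exact Ha| |].
      * intros p x Hx; assert (H := phi_S_pos p x Hx); lra.
      * intros x Hx; rewrite !Gamma_root_eq by lra.
        unfold Rdiv; rewrite <- exp_Ropp, <- exp_plus; f_equal; ring.
  - intros alpha beta Ha Hb; apply (lcm_of_signs _ alpha beta 1 1); [lra|lra|exact Hb| |].
    + intros p x Hx; assert (H := proj1 (phi_S_bounds p x Hx)).
      assert (H1 := He p (x + 1) ltac:(lra)); nra.
    + intros x Hx; rewrite Gamma_root_quotient_eq by lra; f_equal; ring.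
  - apply Rmult_lt_reg_r with (1 + tau0); [lra|].
    unfold Rdiv; rewrite Rmult_assoc, Rinv_l; lra.
  - intros alpha beta Hb Ha; apply (lcm_of_signs _ alpha beta 1 (-1)); [lra|lra|exact Hb| |].
    + intros p x Hx; assert (H := proj2 (phi_S_bounds p x Hx)).
      assert (H1 := He p (x + 1) ltac:(lra)).
      (* [Ha] is multiplied by a positive quantity, so this covers [alpha] of either sign. *)
      apply (Rmult_le_compat_r _ _ _ (Rlt_le _ _ H1)) in Ha.
      apply (Rmult_le_compat_l (1 / (1 + tau0))) in H; [|apply Rlt_le, Rdiv_lt_0_compat; lra].
      rewrite <- Rmult_assoc in H.
      replace (1 / (1 + tau0) * (1 + tau0)) with 1 in H by (field; lra); lra.
    + intros x Hx; rewrite Gamma_root_quotient_eq by lra.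
      rewrite <- exp_Ropp; f_equal; ring.
  - intros alpha beta Ha Hb; apply (lcm_of_signs _ alpha beta 0 1); [lra|lra|exact Hb| |].
    + intros p x Hx; assert (H := proj1 (phi_S_bounds p x ltac:(lra))).
      assert (H1 := He p (x + 0) ltac:(lra)).
      (* Moving the pole from -1 to 0 only enlarges the logarithmic term, so the bound from (b)
         carries over. *)
      assert (H2 : INR (fact p) / (x + 1) ^ S p <= INR (fact p) / (x + 0) ^ S p).
      { apply Rmult_le_compat_l; [apply pos_INR|].
        apply Rinv_le_contravar; [apply pow_lt; lra | apply pow_incr; lra]. }
      nra.
    (* The third [x] is the one in [beta / x], rewritten to fit [c = 0]. *)
    + intros x Hx; rewrite <- (Rplus_0_r x) at 3.
      rewrite Gamma_root_quotient_eq by lra; f_equal; ring.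
  - intros alpha beta Ha Hb; apply (lcm_of_signs _ alpha beta 0 (-1)); [lra|lra|exact Hb| |].
    + intros p x Hx; assert (H := phi_S_pos p x ltac:(lra)).
      assert (H1 := He p (x + 0) ltac:(lra)); nra.
    + intros x Hx; rewrite <- (Rplus_0_r x) at 3.
      rewrite Gamma_root_quotient_eq by lra.
      rewrite <- exp_Ropp; f_equal; ring.
Qed.
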